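(* Let $n>0$ and let $\alpha$ be a composition of $n$. The core label order $\mathrm{CLO}(\mathrm{Tam}(\alpha))$ of $\mathrm{Tam}(\alpha)$ is a meet-semilattice. It is a lattice if and only if $\alpha=(n)$ or $\alpha=(1,1,\ldots,1)$.
   Context: Let $n>0$ and let $\alpha=(\alpha_1,\ldots,\alpha_r)$ be a composition of $n$ (a sequence of positive integers with sum $n$). Put $[n]=\{1,\ldots,n\}$, $p_0=0$ and $p_i=\alpha_1+\cdots+\alpha_i$. The $i$-th $\alpha$-region is $\{p_{i-1}+1,\ldots,p_i\}$. For $w$ in the symmetric group $\mathfrak{S}_n$ write $w_i=w(i)$ and $\mathrm{Inv}(w)=\{(i,j): i<j,\ w_i>w_j\}$. The (left) weak order on $\mathfrak{S}_n$ is $u\leq_L v$ iff $\mathrm{Inv}(u)\subseteq\mathrm{Inv}(v)$. Let $\mathfrak{S}_\alpha$ be the set of $w\in\mathfrak{S}_n$ with $w_i<w_{i+1}$ for all $i\in[n-1]\setminus\{p_1,\ldots,p_{r-1}\}$. An $(\alpha,231)$-pattern in $w\in\mathfrak{S}_\alpha$ is a triple $(i,j,k)$ with $i<j<k$ all in different $\alpha$-regions such that $w_k<w_i<w_j$ and $w_i=w_k+1$. Let $\mathfrak{S}_\alpha(231)$ be the set of $w\in\mathfrak{S}_\alpha$ having no $(\alpha,231)$-pattern, and let $\mathrm{Tam}(\alpha)$ be the poset $(\mathfrak{S}_\alpha(231),\leq_L)$; it is a finite lattice. Let $\mathbf{L}=(L,\leq)$ be a finite lattice; $a\lessdot b$ denotes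 a cover relation. An element $j\neq\hat0$ is join irreducible if $j=a\vee b$ implies $j\in\{a,b\}$; it then covers a unique element $j_*$. For $a\lessdot b$ let $\mathrm{cg}(a,b)$ be the finest lattice congruence of $\mathbf{L}$ identifying $a$ and $b$, and put $\mathrm{cg}(j)=\mathrm{cg}(j_*,j)$. $\mathbf{L}$ is congruence uniform if $j\mapsto\mathrm{cg}(j)$ is a bijection from the join-irreducible elements of $\mathbf{L}$ to the join-irreducible elements of the congruence lattice of $\mathbf{L}$, and likewise for the dual of $\mathbf{L}$. In that case every cover relation $a\lessdot b$ gets the label $\lambda(a,b)$, the unique join-irreducible $j$ with $\mathrm{cg}(j)=\mathrm{cg}(a,b)$. For $a\in L$ let $a_\downarrow$ be the meet of all elements covered by $a$ (with $a_\downarrow=a$ if $a=\hat0$), and let the core label set be $\Psi(a)=\{\lambda(b,c): a_\downarrow\leq b\lessdot c\leq a\}$. The core label order $\mathrm{CLO}(\mathbf{L})$ is the poset $(L,\sqsubseteq)$, where $a\sqsubseteq b$ iff $\Psi(a)\subseteq\Psi(b)$. The lattice $\mathrm{Tam}(\alpha)$ is congruence uniform, so $\mathrm{CLO}(\mathrm{Tam}(\alpha))$ is defined. *)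

(* Defs.v *)
From HB Require Import structures.
From mathcomp Require Import all_boot all_order all_fingroup.

Set Implicit Arguments.
Unset Strict Implicit.
Unset Printing Implicit Defensive.

Import Order.TTheory.

Section OrderRelation.
Variables (T : finType) (r : rel T).
Implicit Types (x y z : T) (A : {set T}).

Definition is_inf A z :=
  [forall x in A, r z x] && [forall t, [forall x in A, r t x] ==> r t z].

Definition is_sup A z :=
  [forall x in A, r x z] && [forall t, [forall x in A, r x t] ==> r z t].

Definition partial_order : Prop :=
  [/\ reflexive r, antisymmetric r & transitive r].

Definition meet_semilattice : Prop :=
  partial_order /\ forall x y, exists z, is_inf [set x; y] z.

Definition join_semilattice : Prop :=
  partial_order /\ forall x y, exists z, is_sup [set x; y] z.

Definition lattice : Prop := meet_semilattice /\ join_semilattice.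

End OrderRelation.

(* Joins and meets are handled through the predicates [is_join] and [is_meet],
   so that the notions below can be applied to a poset that is a lattice
   without first endowing it with lattice operations. They have their intended
   meaning only when [L] is a lattice. *)
Section CoreLabelOrder.
Variables (d : Order.disp_t) (L : finPOrderType d).
Implicit Types (a b c j x y z : L) (th : {set L * L}).
Local Open Scope order_scope.

Definition is_meet x y z := is_inf (@Order.le d L) [set x; y] z.
Definition is_join x y z := is_sup (@Order.le d L) [set x; y] z.

Definition is_bottom x := [forall y, x <= y].

Definition covered a b := (a < b) && [forall c, ~~ ((a < c) && (c < b))].

(* A binary relation on [L] is represented by its graph. *)
Definition lattice_congruence th :=
  [&& [forall x, (x, x) \in th],
      [forall x, forall y, ((x, y) \in th) ==> ((y, x) \in th)],
      [forall x, forall y, forall z,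
         ((x, y) \in th) && ((y, z) \in th) ==> ((x, z) \in th)],
      [forall x, forall x', forall y, forall y', forall z, forall z',
         [&& (x, x') \in th, (y, y') \in th, is_join x y z & is_join x' y' z']
           ==> ((z, z') \in th)]
    & [forall x, forall x', forall y, forall y', forall z, forall z',
         [&& (x, x') \in th, (y, y') \in th, is_meet x y z & is_meet x' y' z']
           ==> ((z, z') \in th)]].

Definition cg a b : {set L * L} :=
  \bigcap_(th : {set L * L} | lattice_congruence th && ((a, b) \in th)) th.

Definition join_irreducible j :=
  ~~ is_bottom j &&
  [forall a, forall b, is_join a b j ==> ((j == a) || (j == b))].

(* The default value of [odflt] is irrelevant: a join-irreducible element of a
   finite lattice covers exactly one element. *)
Definition lower_star j := odflt j [pick s | covered s j].

Definition cgj j := cg (lower_star j) j.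

(* [is_label b c j] states that [j] is the label of the cover relation from [b]
   to [c]; such a [j] is unique when [L] is congruence uniform. *)
Definition is_label b c j := join_irreducible j && (cgj j == cg b c).

Definition nucleus a :=
  if is_bottom a then a
  else odflt a [pick m | is_inf (@Order.le d L) [set b | covered b a] m].

Definition core_label_set a : {set L} :=
  [set j | [exists b, exists c,
     [&& nucleus a <= b, covered b c, c <= a & is_label b c j]]].

Definition CLO : rel L :=
  fun a b => core_label_set a \subset core_label_set b.

End CoreLabelOrder.

Definition is_composition (n : nat) (alpha : seq nat) :=
  all (fun a => 0 < a) alpha && (sumn alpha == n).

Definition psum (alpha : seq nat) (i : nat) := sumn (take i alpha).

(* The position [x] of the paper's [n] = {1, ..., n} is the ordinal [x - 1] of
   ['I_n]; values of permutations are shifted in the same way. *)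
Section ParabolicTamari.
Variables (n : nat) (alpha : seq nat).
Implicit Types (w : 'S_n) (i j k : 'I_n).

Definition same_region i j :=
  [exists m : 'I_(size alpha),
     (psum alpha m <= i < psum alpha m.+1) &&
     (psum alpha m <= j < psum alpha m.+1)].

Definition inversions w : {set 'I_n * 'I_n} :=
  [set ij : 'I_n * 'I_n | (ij.1 < ij.2) && (w ij.2 < w ij.1)].

(* [j = i.+1] is the 0-based index of the position following [i], and hence
   also the 1-based index of [i] itself. *)
Definition parabolic w :=
  [forall i : 'I_n, forall j : 'I_n,
     (j == i.+1 :> nat) &&
     ((j : nat) \notin [seq psum alpha m | m <- iota 1 (size alpha).-1])
       ==> (w i < w j)].

Definition pattern231 w i j k :=
  [&& i < j, j < k,
      ~~ same_region i j, ~~ same_region j k, ~~ same_region i k,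
      w k < w i, w i < w j & w i == (w k).+1 :> nat].

Definition avoids231 w :=
  [forall i : 'I_n, forall j : 'I_n, forall k : 'I_n, ~~ pattern231 w i j k].

Record tamari := Tamari {
  tamari_val :> 'S_n;
  _ : parabolic tamari_val && avoids231 tamari_val }.

HB.instance Definition _ := [isSub for tamari_val].
HB.instance Definition _ := [Finite of tamari by <:].

End ParabolicTamari.

Lemma inversions_inj n : injective (@inversions n).
Proof.
move=> u v Euv.
have lt_uv (i j : 'I_n) : (u i < u j) = (v i < v j).
  have invE (w : 'S_n) (a b : 'I_n) : a < b ->
      ((a, b) \in inversions w) = (w b < w a).
    by move=> lt_ab; rewrite inE /= lt_ab.
  have [lt_ij|lt_ji|/val_inj->] := ltngtP i j; last by rewrite !ltnn.
  - have ltE (w : 'S_n) : (w i < w j) = ~~ (w j < w i).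
      rewrite -leqNgt ltn_neqAle.
      by rewrite (inj_eq val_inj) (inj_eq perm_inj) -val_eqE /= ltn_eqF.
    by rewrite !ltE -!invE // Euv.
  - by rewrite -!invE // Euv.
have rankE (w : 'S_n) (i : 'I_n) : #|[set j | w j < w i]| = w i.
  have -> : [set j | w j < w i] = w @^-1: [set k : 'I_n | k < w i].
    by apply/setP=> j; rewrite !inE.
  rewrite card_preimset; last exact: perm_inj.
  rewrite -sum1dep_card -(big_ord_widen n (fun=> 1)) ?sum1_card ?card_ord //.
  exact/ltnW/ltn_ord.
apply/permP=> i; apply: val_inj; rewrite /= -(rankE u) -(rankE v).
by apply: eq_card => j; rewrite !inE lt_uv.
Qed.

Section WeakOrder.
Variables (n : nat) (alpha : seq nat).
Implicit Types u v w : tamari n alpha.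

Definition weak_le u v := inversions u \subset inversions v.

Fact weak_le_refl : reflexive weak_le.
Proof. by move=> u; apply: subxx. Qed.

Fact weak_le_anti : antisymmetric weak_le.
Proof.
by move=> u v Euv; apply/val_inj/inversions_inj/eqP; rewrite eqEsubset.
Qed.

Fact weak_le_trans : transitive weak_le.
Proof. by move=> v u w; apply: subset_trans. Qed.

Fact weak_display : Order.disp_t. Proof. exact: Order.Disp tt tt. Qed.

HB.instance Definition _ := Order.Le_isPOrder.Build weak_display
  (tamari n alpha) weak_le_refl weak_le_anti weak_le_trans.

End WeakOrder.

Definition Tam (n : nat) (alpha : seq nat) : finPOrderType weak_display :=
  tamari n alpha.

(* Main.v *)
(* An element w is encoded by the set R(w) of arcs (i, j), with i < j in
   different regions, such that w k < w i for every k beyond the region of i up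
   to j. The sets R(w) are exactly the arc-closed ones, so Tam(alpha) is a
   closure system with intersection as meet. Its join-irreducibles are the
   principal sets R = arc_down p, one for each arc p. A cover x < y is
   perspective to the cover of the join-irreducible of any minimal arc of R(y)
   outside R(x), and restricting R to all arcs shorter than p together with p
   is a congruence that separates p from every other arc at least as long; so
   labels are arcs, and the core label set of w is the set of those (i, j) in
   R(w) such that the values between w j and w i sit at ends of regions between
   i and j. These sets are closed under intersection: for A the intersection of
   those of u and v, the w whose inversions are generated by the arcs below A
   has core label set A. Hence CLO is a meet-semilattice, and it is a lattice
   if and only if it has a maximum, i.e. some w carries all arcs. Then no
   region with two elements can coexist with another region. *)
Require Import Defs.
From mathcomp Require Import all_boot all_order all_fingroup.
From mathcomp Require Import zify.

Set Implicit Arguments.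
Unset Strict Implicit.
Unset Printing Implicit Defensive.

Import Order.TTheory.

(** * Finite posets and congruences *)

Lemma is_infP (T : finType) (r : rel T) (A : {set T}) z :
  reflect ((forall x, x \in A -> r z x) /\
           forall t, (forall x, x \in A -> r t x) -> r t z)
          (is_inf r A z).
Proof.
apply: (iffP andP) => -[zA zmax]; split.
- by move=> x xA; move/forallP/(_ x): zA; rewrite xA.
- move=> t tA; move/forallP/(_ t): zmax => /implyP; apply.
  by apply/forallP => x; apply/implyP/tA.
- by apply/forallP => x; apply/implyP/zA.
- apply/forallP => t; apply/implyP => /forallP tA; apply: zmax => x xA.
  by have := tA x; rewrite xA.
Qed.

Lemma is_supP (T : finType) (r : rel T) (A : {set T}) z :
  reflect ((forall x, x \in A -> r x z) /\
           forall t, (forall x, x \in A -> r x t) -> r z t)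
          (is_sup r A z).
Proof. exact: (is_infP (fun x y => r y x)). Qed.

Section Congruence.
Variables (disp : Order.disp_t) (L : finPOrderType disp) (th : {set L * L}).
Hypothesis thP : lattice_congruence th.
Implicit Types x y z : L.

Lemma congruence_refl x : (x, x) \in th.
Proof. by case/and5P: thP => /forallP. Qed.

Lemma congruence_join x x' y y' z z' : (x, x') \in th -> (y, y') \in th ->
  is_join x y z -> is_join x' y' z' -> (z, z') \in th.
Proof.
case/and5P: thP => _ _ _ /forallP/(_ x)/forallP/(_ x')/forallP/(_ y)/forallP/(_
  y').
by move=> /forallP/(_ z)/forallP/(_ z')/implyP J _ xx yy zJ zJ'; apply: J;
  apply/and4P.
Qed.

Lemma congruence_meet x x' y y' z z' : (x, x') \in th -> (y, y') \in th ->
  is_meet x y z -> is_meet x' y' z' -> (z, z') \in th.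
Proof.
case/and5P: thP => _ _ _ _ /forallP/(_ x)/forallP/(_ x')/forallP/(_
  y)/forallP/(_ y').
by move=> /forallP/(_ z)/forallP/(_ z')/implyP J xx yy zJ zJ'; apply: J;
  apply/and4P.
Qed.

End Congruence.

(** A join is a common upper bound with the smallest down-set: its meet with any other common upper
    bound is again one, so it cannot be strictly smaller. Conversely, joins force an element with a
    largest down-set to be the maximum; [x0] provides a candidate. *)
Lemma lattice_topP (T : finType) (r : rel T) (x0 : T) : meet_semilattice r ->
  lattice r <-> exists t, forall x, r x t.
Proof.
move=> rM; have [[rr ra rt] meet] := rM.
pose height x := #|[set y | r y x]|.
have height_eq x y : r x y -> height y <= height x -> r y x.
  move=> xy yx; have sub : [set z | r z x] \subset [set z | r z y].
    by apply/subsetP => z; rewrite !inE => /rt; apply.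
  have /eqP/setP/(_ y) :
    [set z | r z x] == [set z | r z y] by rewrite eqEcard sub.
  by rewrite !inE rr.
split=> [[_ [_ join]]|[t tP]].
  have x0P : predT x0 by [].
  case: (arg_maxnP height x0P) => t _ tmax; exists t => x.
  have [z /is_supP[zP _]] := join x t.
  have [xz tz] : r x z /\ r t z by rewrite !zP ?set21 ?set22.
  by apply: rt xz _; apply: height_eq => //; apply: tmax.
split=> //; split=> // x y.
pose U := [pred u | r x u && r y u].
have tU : U t by rewrite /= !tP.
case: (arg_minnP height tU) => z /andP[xz yz] zmin; exists z.
apply/is_supP; split=> [u /set2P[]->//|u uP].
have [m /is_infP[mP mmax]] := meet z u.
have [mz mu] : r m z /\ r m u by rewrite !mP ?set21 ?set22.
apply: rt mu; apply: height_eq => //; apply: zmin; apply/andP.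
split; apply: mmax => v /set2P[]-> //; apply: uP; rewrite ?set21 ?set22 //.
Qed.

(** * Permutations and their inversions *)

Lemma perm_lt_total n (w : 'S_n) (i j : 'I_n) :
  i != j :> nat -> (w i < w j) = ~~ (w j < w i).
Proof.
move=> ne; rewrite -leqNgt ltn_neqAle; case: eqP => // /val_inj/perm_inj ij.
by rewrite ij eqxx in ne.
Qed.

Lemma perm_preim n (w : 'S_n) (m : nat) : m < n -> exists p, w p = m :> nat.
Proof. by move=> lt_m; exists ((w^-1)%g (Ordinal lt_m)); rewrite permKV. Qed.

Lemma perm_val_inj n (w : 'S_n) (i j : 'I_n) : w i = w j :> nat -> i = j.
Proof. by move/val_inj/perm_inj. Qed.

(** Reversing the natural order on exactly the pairs of [T] gives a linear order [lt], because [T]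
    is transitive and cotransitive. The value at [x] is its rank in [lt]. *)
Lemma perm_of_inversions n (T : rel 'I_n) :
    (forall i j, T i j -> i < j) -> transitive T ->
    (forall i j k : 'I_n, i < j -> j < k -> T i k -> T i j || T j k) ->
  exists w : 'S_n, forall i j : 'I_n, i < j -> (w j < w i) = T i j.
Proof.
move=> T_lt T_tr T_co.
pose lt (x y : 'I_n) := ((x < y) && ~~ T x y) || T y x.
have ltxx x : lt x x = false.
  by rewrite /lt ltnn /=; apply/negbTE/negP => /T_lt; rewrite ltnn.
have lt_tr x y z : lt x y -> lt y z -> lt x z.
  rewrite /lt => /orP[/andP[xy nT]|Tyx] /orP[/andP[yz nT']|Tzy].
  - apply/orP; left; rewrite (ltn_trans xy yz) /=; apply/negP => Txz.
    by case/orP: (T_co _ _ _ xy yz Txz); apply/negP.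
  - have zy := T_lt _ _ Tzy; have [xz|zx|/val_inj xz] := ltngtP x z.
    + by rewrite orbC /=; case: (T z x) => //=; apply: contra nT => /T_tr;
      apply.
    + by have := T_co _ _ _ zx xy Tzy; rewrite (negPf nT) orbF.
    + by rewrite xz Tzy in nT.
  - have yx := T_lt _ _ Tyx; have [xz|zx|/val_inj xz] := ltngtP x z.
    + by rewrite orbC /=; case: (T z x) => //=; apply: contra nT'; apply: T_tr.
    + by have := T_co _ _ _ yz zx Tyx; rewrite (negPf nT').
    + by rewrite -xz Tyx in nT'.
  - by rewrite (T_tr _ _ _ Tzy Tyx) orbT.
have lt_total x y : x != y -> lt x y || lt y x.
  by rewrite -val_eqE /= /lt => ne; case: ltngtP ne => // _ _; case: (T x y);
    case: (T y x).
pose rank (x : 'I_n) := #|[set y | lt y x]|.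
have rank_lt x : rank x < n.
  rewrite -[X in _ < X](card_ord n) -cardsT; apply: proper_card.
  by rewrite properT; apply/eqP => /setP/(_ x); rewrite !inE ltxx.
have rank_mono x y : lt x y -> rank x < rank y.
  move=> xy; apply: proper_card; apply/properP; split; last by exists x;
    rewrite !inE ?ltxx.
  by apply/subsetP => z; rewrite !inE => /lt_tr; apply.
have rank_inj : injective (fun x => Ordinal (rank_lt x)).
  move=> x y [/eqP]; apply: contraTeq => /lt_total/orP[]/rank_mono; lia.
exists (perm rank_inj) => i j ij; rewrite !permE /=.
case: (boolP (T i j)) => Tij; first by apply: rank_mono; rewrite /lt Tij orbT.
by apply/negbTE; rewrite -leqNgt ltnW // rank_mono // /lt ij Tij.
Qed.

(** * Regions of a composition *)

Section RegionEnd.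
Variables (n : nat) (alpha : seq nat).
Hypothesis alphaP : is_composition n alpha.
Implicit Types i j k : 'I_n.

Lemma psumS m : psum alpha m.+1 = psum alpha m + nth 0 alpha m.
Proof.
rewrite /psum; case: (ltnP m (size alpha)) => lt_m.
  by rewrite (take_nth 0) // sumn_rcons.
by rewrite nth_default // addn0 !take_oversize // ltnW.
Qed.

Lemma leq_psum : {homo psum alpha : a b / a <= b}.
Proof.
move=> a b /subnK <-; elim: (b - a) => [|c IHc] //.
by rewrite addSn psumS (leq_trans IHc) // leq_addr.
Qed.

Lemma psum_size : psum alpha (size alpha) = n.
Proof. by rewrite /psum take_size; case/andP: alphaP => _ /eqP. Qed.

Lemma region_ex i :
  exists2 m, m < size alpha & psum alpha m <= i < psum alpha m.+1.
Proof.
suff main s : s <= size alpha -> i < psum alpha s ->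
    exists2 m, m < size alpha & psum alpha m <= i < psum alpha m.+1.
  by apply: (main (size alpha)); rewrite ?psum_size.
elim: s => [|s IHs] lt_s; first by rewrite /psum take0.
case: (ltnP i (psum alpha s)) => [lt_i _|le_i lt_i]; last by exists s;
  rewrite ?le_i.
exact: IHs (ltnW lt_s) lt_i.
Qed.

Lemma same_regionP i j m : psum alpha m <= i < psum alpha m.+1 ->
  same_region alpha i j = (psum alpha m <= j < psum alpha m.+1).
Proof.
move=> mi; apply/existsP/idP => [[m' /andP[m'i m'j]]|mj].
  suff -> : m = m' by [].
  have [lt_m|lt_m|//] := ltngtP m m'.
    by have := leq_psum lt_m; lia.
  by have := leq_psum lt_m; lia.
have lt_m : m < size alpha.
  rewrite ltnNge; apply/negP => le_m.
  by have := leq_psum le_m; rewrite psum_size; have := ltn_ord i; lia.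
by exists (Ordinal lt_m); rewrite mi.
Qed.

Lemma same_region_refl i : same_region alpha i i.
Proof. by have [m _ mi] := region_ex i; rewrite (same_regionP _ mi). Qed.

(** Regions are handled through their last positions: [e i < j] says that [j] lies in a later region
    than [i], [e i = e j] that they share one, and [e k = k] that [k] closes its region. *)
Definition region_end i : 'I_n :=
  [arg max_(j > i | same_region alpha i j) (j : nat)].
Local Notation e := region_end.

Lemma region_end_ge i : i <= e i.
Proof.
rewrite /e; case: arg_maxnP => [|j _]; first exact: same_region_refl.
by apply; exact: same_region_refl.
Qed.

Lemma region_end_same i : same_region alpha i (e i).
Proof. by rewrite /e; case: arg_maxnP => //; exact: same_region_refl. Qed.

Lemma region_end_max i j : same_region alpha i j -> j <= e i.
Proof. by rewrite /e; case: arg_maxnP => [|j' _];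
  [exact: same_region_refl|apply]. Qed.

Lemma region_endP i j : i <= j -> same_region alpha i j = (j <= e i).
Proof.
move=> le_ij; apply/idP/idP; first exact: region_end_max.
have [m _ mi] := region_ex i; have := region_end_same i.
by rewrite !(same_regionP _ mi); lia.
Qed.

Lemma region_end_eq i j : i <= j -> j <= e i -> e j = e i :> nat.
Proof.
move=> le_ij le_j; have: same_region alpha i j by rewrite region_endP.
have [m _ mi] := region_ex i; rewrite (same_regionP _ mi) => mj.
by apply/eqP; rewrite eqn_leq !region_end_max //;
  [have := region_end_same i|have := region_end_same j];
  rewrite !(same_regionP _ mi, same_regionP _ mj).
Qed.

Lemma region_end_id i : e (e i) = e i :> nat.
Proof. by apply: region_end_eq; rewrite ?region_end_ge. Qed.

Lemma region_end_mono i j : i <= j -> e i <= e j.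
Proof.
move=> le_ij; case: (leqP j (e i)) => [/(region_end_eq le_ij)->//|lt_j].
by rewrite (leq_trans (ltnW lt_j)) ?region_end_ge.
Qed.

(** A 0-based position opens a region when it is a partial sum. The sum 0 is excluded by [j = i.+1]
    and the full sum [n] by [j < n], which matches the range of [iota]. *)
Lemma region_end_next i j : j = i.+1 :> nat ->
  ((j : nat) \notin [seq psum alpha m | m <- iota 1 (size alpha).-1]) =
  (j <= e i).
Proof.
move=> ji; rewrite -region_endP; last by rewrite ji.
have [m lt_m mi] := region_ex i; rewrite (same_regionP _ mi).
apply/idP/idP => [/mapP nj|mj]; last first.
  apply/mapP => -[m' _ jm'].
  have [le_m|lt_m'] := leqP m' m; first by have := leq_psum le_m; lia.
  by have := leq_psum lt_m'; lia.
case: (ltnP j (psum alpha m.+1)) => [|le_j]; first by lia.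
case: nj; exists m.+1; last by lia.
rewrite mem_iota add1n /=; case: (ltnP m.+1 (size alpha)) => [|le_m];
  first by lia.
by have := leq_psum le_m; rewrite psum_size; have := ltn_ord j; lia.
Qed.

Section Perm.
Variable w : 'S_n.

Lemma parabolicP :
  reflect (forall i j, i < j -> j <= e i -> w i < w j) (parabolic alpha w).
Proof.
apply: (iffP forallP) => [wP i j lt_ij le_j|wP i]; last first.
  apply/forallP => j; apply/implyP => /andP[/eqP ji].
  by rewrite (region_end_next ji); apply: wP; rewrite ji.
have [d jE] : exists d, j = (i + d).+1 :> nat by exists (j - i.+1); lia.
elim: d j jE le_j {lt_ij} => [|d IHd] j jE le_j.
  have ji : j = i.+1 :> nat by rewrite jE addn0.
  by have /forallP/(_ j) := wP i; rewrite (region_end_next ji) le_j ji eqxx.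
have lt_j : (i + d).+1 < n by have := ltn_ord j; lia.
have ltj' : w i < w (Ordinal lt_j) by apply: IHd => //=; lia.
apply: (ltn_trans ltj').
have /forallP/(_ j) := wP (Ordinal lt_j).
have jE' : j = (Ordinal lt_j).+1 :> nat by rewrite /= jE addnS.
rewrite (region_end_next jE') jE' eqxx -jE' /= => /implyP; apply.
by rewrite (region_end_eq (i := i)) //=; lia.
Qed.

Lemma avoids231P :
  reflect (forall i j k, e i < j -> e j < k -> w i = (w k).+1 :> nat ->
             w j < w i)
          (avoids231 alpha w).
Proof.
have nsr i j : i < j -> same_region alpha i j = (j <= e i).
  by move=> /ltnW; apply: region_endP.
apply: (iffP idP) => [/forallP wP i j k lt_j lt_k wik|wP].
  have lt_ij : i < j by have := region_end_ge i; lia.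
  have lt_jk : j < k by have := region_end_ge j; lia.
  have := wP i => /forallP/(_ j)/forallP/(_ k); apply: contraR.
  rewrite -leqNgt => le_w; have lt_w : w i < w j.
    rewrite ltn_neqAle le_w andbT; apply/eqP => /val_inj/perm_inj ij.
    by rewrite ij ltnn in lt_ij.
  have lt_ik := ltn_trans lt_ij lt_jk.
  rewrite /pattern231 lt_ij lt_jk !nsr //.
  by rewrite -!ltnNge lt_j lt_k (ltn_trans lt_j) // lt_w wik leqnn eqxx.
rewrite /avoids231; apply/forallP => i; apply/forallP => j; apply/forallP => k.
apply/negP; rewrite /pattern231 => /and5P[lt_ij lt_jk].
rewrite !nsr //; last exact: ltn_trans lt_jk.
rewrite -!ltnNge => lt_j lt_k /and4P[_ _ lt_w /eqP wik].
by have := wP _ _ _ lt_j lt_k wik; lia.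
Qed.

End Perm.

End RegionEnd.

(** * The arcs of an element of the Tamari lattice *)

Section Tamari.
Variables (n : nat) (alpha : seq nat).
Hypothesis alphaP : is_composition n alpha.
Local Notation e := (@region_end n alpha).
Local Notation I := 'I_n.
Local Notation Tm := (tamari n alpha).
Implicit Types (i j k l a b c d : I) (u v w : Tm) (R S : {set I * I}).

Let e_ge i : i <= e i. Proof. exact: region_end_ge. Qed.
Let e_eq i j : i <= j -> j <= e i -> e j = e i :> nat.
Proof. exact: region_end_eq. Qed.
Let e_id i : e (e i) = e i :> nat. Proof. exact: region_end_id. Qed.
Let e_mono i j : i <= j -> e i <= e j. Proof. exact: region_end_mono. Qed.

Lemma tamari_parabolic w i j : i < j -> j <= e i -> w i < w j.
Proof. by case: w => w /= /andP[/(parabolicP alphaP) wP _]; apply: wP. Qed.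

Lemma tamari_avoids w i j k :
  e i < j -> e j < k -> w i = (w k).+1 :> nat -> w j < w i.
Proof. by case: w => w /= /andP[_ /(avoids231P alphaP) wP]; apply: wP. Qed.

(* Among the 231-occurrences on (i, j, k), descend from w i to w k one value
   at a time: the first position met outside the region of j yields a shorter
   occurrence. *)
Lemma tamari_block w i j k : e i < j -> e j < k -> w k < w i -> w i < w j ->
  exists2 x, e x = e j :> nat & w k < w x < w i.
Proof.
have [m] := ubnP (w i - w k); elim: m i k => // m IHm i k le_m ij jk ki wij.
have [p wp] : exists p, w p = (w i).-1 :> nat.
  by apply: perm_preim; have := ltn_ord (w i); lia.
have [wkp|wkp] := eqVneq (w k : nat) (w p).
  by have := @tamari_avoids w i j k ij jk; lia.
have [pj|pj] := eqVneq (e p : nat) (e j); first by exists p => //; lia.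
have [lt_p|lt_p] := ltnP (e p) j.
  by have [|||||x xj xk] := IHm p k; try lia; exists x => //; lia.
have jp : e j < p.
  rewrite ltnNge; apply/negP => le_p; case/negP: pj; apply/eqP.
  by case: (leqP p j) => [/e_eq/(_ lt_p)|/ltnW/e_eq]; lia.
by have [|||||x xj xk] := IHm i p; try lia; exists x => //; lia.
Qed.

Definition rset (w : 'S_n) : {set I * I} :=
  [set p : I * I | (e p.1 < p.2) && [forall k : I, (e p.1 < k <= p.2) ==> (w k <
    w p.1)]].

Lemma rsetP (w : 'S_n) i j :
  reflect (e i < j /\ forall k, e i < k -> k <= j ->
    w k < w i) ((i, j) \in rset w).
Proof.
rewrite inE /=; apply: (iffP andP) => -[ij wP]; split=> //.
  by move=> k ik kj; move/forallP/(_ k): wP; rewrite ik kj.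
by apply/forallP => k; apply/implyP => /andP[]; apply: wP.
Qed.

Lemma rset_lt (w : 'S_n) i j : (i, j) \in rset w -> w j < w i.
Proof. by case/rsetP=> ij; apply. Qed.

Definition down_closed R : Prop :=
  (forall i j, (i, j) \in R -> e i < j) /\
  (forall i j i' j', (i, j) \in R -> i <= i' -> e i' = e i :> nat ->
     e i < j' -> j' <= j -> (i', j') \in R).

(** An arc from [k] controls only positions beyond [e k]. When [e k = k], these and the positions
    controlled by [(i, k)] leave no gap, so the two arcs compose. *)
Definition arc_closed R : Prop :=
  down_closed R /\
  (forall i k l, (i, k) \in R -> (k, l) \in R -> e k = k :> nat ->
    (i, l) \in R).

Lemma rset_closed w : arc_closed (rset w).
Proof.
split; [split|] => [i j /rsetP[]//|i j i' j' /rsetP[ij wP] ii' ee ij' jj'|i k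
  l].
  apply/rsetP; split; first by rewrite ee.
  move=> k; rewrite ee => ik kj'.
  apply: (leq_trans (wP k ik (leq_trans kj' jj'))).
  move: ii'; rewrite leq_eqVlt => /orP[/eqP/val_inj->//|ii'].
  by apply/ltnW/tamari_parabolic => //; rewrite -ee.
move=> /rsetP[ik wP] /rsetP[kl wP'] ek; apply/rsetP; split; first by lia.
move=> y iy yl; case: (leqP y k) => [|ky]; first exact: wP.
by apply: (ltn_trans (wP' y _ yl)); [rewrite ek|apply: wP].
Qed.

Lemma weak_leP u v : 
  reflect (forall i j, i < j -> u j < u i -> v j < v i) (weak_le u v).
Proof.
apply: (iffP subsetP) => [uv i j ij uji|uv [i j]]; last first.
  by rewrite !inE /= => /andP[ij uji]; rewrite ij uv.
by have := uv (i, j); rewrite !inE /= ij; apply.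
Qed.

Lemma inversion_far w i j : i < j -> w j < w i -> e i < j.
Proof.
by move=> ij wji; rewrite ltnNge; apply/negP => /(tamari_parabolic w ij); lia.
Qed.

(** If an inversion [(i, j)] of [u] is not an arc, some [k] between them has a larger value than
    [i], and [tamari_block] finds in the region of [k] a position [x] with value between those of
    [j] and [i]. So [(i, j)] splits into two shorter inversions. *)
Lemma rset_mono u v : weak_le u v = (rset u \subset rset v).
Proof.
apply/idP/idP => [/weak_leP uv|/subsetP uv].
  apply/subsetP => -[i j] /rsetP[ij uP]; apply/rsetP; split=> // k ik kj.
  by apply: uv (uP _ ik kj); have := e_ge i; lia.
apply/weak_leP => i j; have [m] := ubnP (j - i).
elim: m i j => // m IHm i j le_m ij uji; have ij' := inversion_far ij uji.
have [|] := boolP ((i, j) \in rset u); first by move/uv/rset_lt.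
rewrite inE /= ij' /= negb_forall => /existsP[k]; rewrite negb_imply.
case/andP => /andP[ik kj]; rewrite -leqNgt => wik.
have {}wik : u i < u k.
  by rewrite perm_lt_total; [rewrite -leqNgt|have := e_ge i; lia].
have {}kj : k < j.
  by rewrite ltn_neqAle kj andbT; apply/eqP => /val_inj kj'; move: wik;
    rewrite kj'; lia.
have kj' : e k < j.
  rewrite ltnNge; apply/negP => jk.
  by have := tamari_parabolic u kj jk; lia.
have [x xk /andP[ujx uxi]] := tamari_block ik kj' uji wik.
have ix : e i < x.
  rewrite ltnNge; apply/negP => le_x; have := e_mono le_x.
  by rewrite e_id xk; have := e_ge k; lia.
have xj : x < j by have := e_ge x; lia.
have := IHm i x; have := IHm x j; have := e_ge i; lia.
Qed.

Lemma rset_inj u v : rset u = rset v -> u = v.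
Proof.
by move=> uv; apply: weak_le_anti; rewrite !rset_mono uv subxx.
Qed.

(** * Elements built from down-closed sets of arcs *)

Section Build.
Variable R : {set I * I}.
Hypothesis RP : down_closed R.
Let r : rel I := fun i j => (i, j) \in R.

Let r_far i j : r i j -> e i < j. Proof. by case: RP => + _; apply. Qed.
Let r_lt i j : r i j -> i < j.
Proof. by move/r_far; have := e_ge i; lia. Qed.

Lemma arc_connect_le i j : connect r i j -> i <= j.
Proof.
case/connectP => p; elim: p i =>
  [i _ ->//|k p IHp i] /= /andP[/r_lt ik /IHp kp] /kp.
by lia.
Qed.

Lemma arc_connect_step i j : connect r i j -> i != j ->
  exists2 k, r i k & connect r k j.
Proof.
case/connectP => -[_ -> /eqP//|k p] /= /andP[ik kp] jE _.
by exists k => //; apply/connectP; exists p.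
Qed.

Lemma arc_connect_jump i j k : connect r i k -> i <= j -> j < k ->
  exists p q, [/\ connect r i p, r p q, connect r q k, p <= j & j < q].
Proof.
case/connectP => s; elim: s i => [i _ ->|x s IHs i] /=; first by lia.
case/andP=> ix xs kE ij jk; have [jx|xj] := ltnP j x.
  by exists i, x; split=> //; apply/connectP; exists s.
have [p [q [xp pq qk pj jq]]] := IHs x xs kE xj jk.
by exists p, q; split=> //; apply: connect_trans xp; apply: connect1.
Qed.

Let T i j := (i != j) && connect r i j.

Lemma arc_connect_far i j : connect r i j -> i != j -> e i < j.
Proof. by move=> ij /(arc_connect_step ij)[k /r_far ik /arc_connect_le];
  lia. Qed.

(** Reachability is cotransitive because a path from [i] to [k] jumps over [j] by one arc [(p, q)],
    which shrinks to [(j, q)] if [j] is in the region of [p] and to [(p, j)] otherwise. If [i] and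
    [k] carry consecutive values, no step of the path fits strictly between, so [(i, k)] is itself
    an arc, and [(i, j)] lies below it; this excludes the pattern. *)
Lemma tamari_of_arcs :
  exists w, forall i j, i < j -> (w j < w i) = connect r i j.
Proof.
have TE i j : i < j -> T i j = connect r i j.
  by rewrite /T => ij; case: eqP ij => // ->; rewrite ltnn.
have T_lt i j : T i j -> i < j.
  by case/andP => ne /arc_connect_le;
    rewrite leq_eqVlt => /orP[/eqP/val_inj/eqP|//]; rewrite (negPf ne).
have T_tr : transitive T.
  move=> j i k ij jk; have ik : i < k := ltn_trans (T_lt _ _ ij) (T_lt _ _ jk).
  move: ij jk; rewrite (TE _ _ ik) => /andP[_ ij] /andP[_];
    exact: connect_trans.
have T_co i j k : i < j -> j < k -> T i k -> T i j || T j k.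
  move=> ij jk /andP[_ ik].
  have [p [q [ip pq qk pj jq]]] := arc_connect_jump ik (ltnW ij) jk.
  have [jp|pj'] := leqP j (e p).
    have ejp := e_eq pj jp.
    apply/orP; right; rewrite TE //; apply: connect_trans qk; apply: connect1.
    by apply: (RP.2 p q) => //; apply: r_far.
  apply/orP; left; rewrite TE //; apply: connect_trans ip _; apply: connect1.
  by apply: (RP.2 p q) => //; apply: ltnW.
have [w wT] := perm_of_inversions T_lt T_tr T_co.
have wP : parabolic alpha w && avoids231 alpha w.
  apply/andP; split.
    apply/(parabolicP alphaP) => i j ij je; rewrite perm_lt_total; last by lia.
    by rewrite wT // TE //; apply/negP => /arc_connect_far; rewrite -val_eqE /=;
      lia.
  apply/(avoids231P alphaP) => i j k ij jk wik.
  have ik : i < k by have := e_ge i; have := e_ge j; lia.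
  have ij' : i < j by have := e_ge i; lia.
  have : w k < w i by rewrite wik.
  rewrite wT // TE // => /arc_connect_step[|x ix xk].
    by rewrite -val_eqE /=; lia.
  have [xk'|xk'] := eqVneq x k.
    rewrite wT // TE //; apply: connect1; rewrite xk' in ix.
    by apply: (RP.2 i k) => //; have := e_ge j; lia.
  have lt_ix := r_lt ix.
  have lt_xk : x < k by apply: T_lt; rewrite /T xk'.
  have : w x < w i by rewrite wT // TE // connect1.
  have : w k < w x by rewrite wT // TE //.
  by lia.
by exists (Tamari wP) => i j ij /=; rewrite wT // TE.
Qed.

End Build.

Lemma closed_rset R : arc_closed R -> exists w, rset w = R.
Proof.
move=> [RP R3]; have [w wP] := tamari_of_arcs RP.
exists w; apply/setP => -[i j]; apply/idP/idP => [|ijR]; last first.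
  have ij := RP.1 _ _ ijR; apply/rsetP; split=> // k ik kj.
  rewrite wP; last by have := e_ge i; lia.
  by apply: connect1; apply: (RP.2 i j).
move=> ijw; have [m] := ubnP (j : nat);
  elim: m j ijw => // m IHm j /rsetP[ij wij] le_m.
have : w j < w i by apply: wij.
rewrite wP; last by have := e_ge i; lia.
move=> ijC.
have ij' : i < j by have := e_ge i; lia.
have lt_j : j.-1 < n by have := ltn_ord j; lia.
have [|] := boolP ((i, j) \in R) => // nR.
(* Jumping over the position before [j] singles out the last arc [(p, j)] of the path. *)
have [p [q [ip pq qj pj jq]]] :=
  @arc_connect_jump R i (Ordinal lt_j) j ijC ltac:(rewrite /=; lia)
    ltac:(rewrite /=; lia).
have qE : q = j by apply/val_inj; have := arc_connect_le RP qj; move: jq => /=;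
  lia.
rewrite {}qE in pq jq qj.
case: (eqVneq i p) => [ipE|ne]; first by rewrite -ipE in pq; case/negP: nR.
have ip' := arc_connect_far RP ip ne.
have pq' := RP.1 _ _ pq.
(* The end of the region of [p] is the place to compose: induction gives [(i, e p)], and [(e p, j)]
   lies below [(p, j)]. *)
have ie : (i, e p) \in R.
  apply: IHm; last by have := e_ge p; lia.
  apply/rsetP; split; first by have := e_ge p; lia.
  by move=> k ik kp; apply: wij => //; lia.
case/negP: nR; apply: (R3 i (e p)) => //.
by apply: (RP.2 p j) => //; rewrite ?e_ge ?e_id.
Qed.

(** * Lattice operations and covers *)

Local Notation L := (Tam n alpha).
Implicit Types (x y z t m s : L) (p q : I * I).

Lemma tam_leE x y : (x <= y)%O = (rset x \subset rset y).
Proof. exact: rset_mono. Qed.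

Lemma tam_ltE x y : (x < y)%O = (rset x \proper rset y).
Proof.
rewrite lt_neqAle tam_leE properEneq; congr (~~ _ && _).
by apply/eqP/eqP => [->|/rset_inj].
Qed.

Lemma arc_closedI R S : arc_closed R -> arc_closed S -> arc_closed (R :&: S).
Proof.
move=> [[R1 R2] R3] [[S1 S2] S3]; split; [split|].
- by move=> i j /setIP[/R1].
- move=> i j i' j' /setIP[Rij Sij] *; rewrite inE.
  by rewrite (R2 i j) // (S2 i j).
- move=> i k l /setIP[Rik Sik] /setIP[Rkl Skl] ek; rewrite inE.
  by rewrite (R3 i k) // (S3 i k).
Qed.

Lemma tam_meet x y : exists z, rset z = rset x :&: rset y.
Proof. by apply: closed_rset; apply: arc_closedI; apply: rset_closed. Qed.

Lemma is_meetE x y z : is_meet x y z = (rset z == rset x :&: rset y).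
Proof.
apply/is_infP/eqP => [[zxy zmax]|zE].
  have [z' z'E] := tam_meet x y.
  have le_z u : u \in [set x; y] -> (z' <= u)%O.
    by rewrite tam_leE z'E => /set2P[]->; rewrite ?subsetIl ?subsetIr.
  apply/eqP; rewrite eqEsubset subsetI -!tam_leE !zxy ?set21 ?set22 //=.
  by rewrite -z'E -tam_leE zmax.
split=> [u|t tP]; first by rewrite tam_leE zE => /set2P[]->;
  rewrite ?subsetIl ?subsetIr.
by rewrite tam_leE zE subsetI -!tam_leE !tP ?set21 ?set22.
Qed.

Lemma is_joinP x y z :
  reflect [/\ rset x \subset rset z, rset y \subset rset z &
            forall R, arc_closed R -> rset x \subset R -> rset y \subset R ->
              rset z \subset R]
          (is_join x y z).
Proof.
apply: (iffP (is_supP _ _ _)) => [[xyz zmin]|[xz yz zmin]]; split.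
- by rewrite -tam_leE xyz ?set21.
- by rewrite -tam_leE xyz ?set22.
- move=> R /closed_rset[w <-] xw yw; rewrite -tam_leE.
  by apply: zmin => u /set2P[]->; rewrite tam_leE.
- by move=> u /set2P[]->; rewrite tam_leE.
- move=> t tP; rewrite tam_leE; apply: zmin; first exact: rset_closed.
    by rewrite -tam_leE tP ?set21.
  by rewrite -tam_leE tP ?set22.
Qed.

Lemma coveredP x y :
  reflect ((x < y)%O /\ forall z, (x <= z)%O -> (z <= y)%O -> z = x \/ z = y)
          (covered x y).
Proof.
apply: (iffP andP) => -[xy xyP]; split=> //.
  move=> z xz zy; have [->|xz'] := eqVneq z x; first by left.
  have [->|zy'] := eqVneq z y; first by right.
  by have /forallP/(_ z) := xyP; rewrite !lt_neqAle xz zy zy' eq_sym xz'.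
apply/forallP => z; apply/negP => /andP[xz zy].
by case: (xyP z (ltW xz) (ltW zy)) => zE; [move: xz|move: zy]; rewrite zE ltxx.
Qed.

(** The arc-closed set generated by an arc [p]. As [p] belongs to it exactly when [e p.1 < p.2], the
    condition [p \in arc_down p] serves below to say that [p] is an arc. *)
Definition arc_down p : {set I * I} :=
  [set q : I * I | [&& p.1 <= q.1, e q.1 == e p.1 :> nat, e p.1 < q.2 & q.2 <=
    p.2]].

Lemma arc_downP a b i j :
  reflect [/\ a <= i, e i = e a :> nat, e a < j & j <= b] ((i, j) \in arc_down
    (a, b)).
Proof. by rewrite inE /=; apply: (iffP and4P) => -[? /eqP]. Qed.

Lemma arc_down_refl p : (p \in arc_down p) = (e p.1 < p.2).
Proof. by rewrite inE /= !leqnn eqxx andbT. Qed.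

Lemma arc_down_sub R p : down_closed R -> p \in R -> arc_down p \subset R.
Proof.
case: p => a b RP ab; apply/subsetP => -[i j] /arc_downP[ai ei aj jb].
exact: (RP.2 a b).
Qed.

Lemma arc_down_trans p q : p \in arc_down q -> arc_down p \subset arc_down q.
Proof.
case: p => a b; case: q => c d /arc_downP[ca ea cb bd].
by apply/subsetP => -[i j] /arc_downP[ai ei aj jb]; apply/arc_downP; split; lia.
Qed.

(** Composition is vacuous: all arcs of the set start in one region and end beyond it. *)
Lemma arc_down_closed p : arc_closed (arc_down p).
Proof.
case: p => a b; split; [split|].
- by move=> i j /arc_downP[? -> ? ?].
- move=> i j i' j' /arc_downP[ai ei aj jb] ii' ee ij' jj'.
  by apply/arc_downP; split; lia.
- move=> i k l /arc_downP[ai ei ak kb] /arc_downP[ak' ek ? ?] ekk; lia.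
Qed.

Lemma arc_star_closed p : arc_closed (arc_down p :\ p).
Proof.
case: p => a b; have [[D1 D2] D3] := arc_down_closed (a, b); split; [split|].
- by move=> i j /setD1P[_ /D1].
- move=> i j i' j' /setD1P[ne ij] ii' ee ij' jj'.
  apply/setD1P; split; last exact: (D2 i j).
  apply: contra_neq ne => -[i'E j'E]; case/arc_downP: ij => *.
  by congr pair; apply/val_inj; move: (congr1 val i'E) (congr1 val j'E) => /=;
    lia.
- move=> i k l /setD1P[_ /arc_downP[ai ei ak kb]] /setD1P[_ /arc_downP[ak' ek ?
  ?]] ekk; lia.
Qed.

Lemma rset_down p (w : Tm) : p \in rset w -> arc_down p \subset rset w.
Proof. by apply: arc_down_sub; case: (rset_closed w). Qed.

(** A descent of the inverse permutation: consecutive values in inverted positions. These index the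
    lower covers of [w]. *)
Definition descent (w : 'S_n) i j := (i < j) && (w i == (w j).+1 :> nat).

Lemma descent_rset (w : Tm) i j : descent w i j -> (i, j) \in rset w.
Proof.
case/andP=> ij /eqP wij; have ij' : e i < j by apply: (@inversion_far w); lia.
apply/rsetP; split=> // k ik kj.
have [jk|kj'] := leqP j (e k); last exact: (@tamari_avoids w i k j).
have [->|ne] := eqVneq k j; first by lia.
have := @tamari_parabolic w k j; move: ne; rewrite -val_eqE /=; lia.
Qed.

(** Go from [w i] down to [w j] by unit steps. Each step is either a descent of [w], hence inverted
    in [m], or not an inversion of [w], hence not one of [m]; either way [m] decreases along it. *)
Lemma descents_generate (m w : Tm) : rset m \subset rset w ->
  (forall i j, descent w i j -> (i, j) \in rset m) -> m = w.
Proof.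
rewrite -rset_mono => mw dP; apply: weak_le_anti; rewrite mw /=.
apply/weak_leP => i j _; have [d] := ubnP (w i - w j).
elim: d i => // d IHd i le_d wji.
have [k wk] : exists k, w k = (w i).-1 :> nat.
  by apply: perm_preim; have := ltn_ord (w i); lia.
have ki : m k < m i.
  have [ik|ik|/val_inj ik] := ltngtP i k; last by move: wk wji; rewrite ik; lia.
    by apply: rset_lt; apply: dP; rewrite /descent ik; lia.
  rewrite perm_lt_total; last by lia.
  by apply/negP => /(weak_leP _ _ mw _ _ ik); lia.
have [kj|kj] := eqVneq (w k : nat) (w j); first by move/perm_val_inj: kj => <-.
by apply: ltn_trans ki; apply: IHd; lia.
Qed.

Lemma bottom_of_no_descent (w : L) :
  (forall p, ~~ descent w p.1 p.2) -> is_bottom w.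
Proof.
move=> no_d; apply/forallP => y; have [z zE] := tam_meet w y.
have <- : z = w.
  apply: descents_generate; first by rewrite zE subsetIl.
  by move=> i j dij; have := no_d (i, j); rewrite /= dij.
by rewrite tam_leE zE subsetIr.
Qed.

Definition rset_minus (w : 'S_n) i j :=
  [set p in rset w | (i, j) \notin arc_down p].

Lemma in_rset_minus (w : 'S_n) i j p :
  (p \in rset_minus w i j) = (p \in rset w) && ((i, j) \notin arc_down p).
Proof. by rewrite inE. Qed.

(** If a composite through [k] lies above [(i, j)], either its first factor does, or [k < j] and
    [w k] would lie strictly between the consecutive values [w j] and [w i]. *)
Lemma rset_minus_closed (w : Tm) i j : descent w i j ->
  arc_closed (rset_minus w i j).
Proof.
move=> dij; have [[R1 R2] R3] := rset_closed w; split; [split|].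
- by move=> a b; rewrite in_rset_minus => /andP[/R1].
- move=> a b a' b'; rewrite !in_rset_minus => /andP[ab nij] aa ea ab' bb.
  rewrite (R2 a b) //=; apply: contra nij; apply/subsetP/arc_down_trans.
  by apply/arc_downP; rewrite ?(R1 a b).
- move=> a k b; rewrite !in_rset_minus => /andP[ak nak] /andP[kb nkb] ek.
  rewrite (R3 a k) //=; apply: contra nak => /arc_downP[ai ei aj jb].
  apply/arc_downP; split=> //; rewrite leqNgt; apply/negP => kj.
  have : w k < w i.
    by apply/rset_lt/(R2 a k) => //; case/rsetP: ak.
  have : w j < w k.
    by apply/rset_lt/(R2 k b) => //; rewrite ek.
  by case/andP: dij => _; lia.
Qed.

Lemma descent_down (w : Tm) i j a b : descent w i j -> (a, b) \in rset w ->
  (i, j) \in arc_down (a, b) -> a = i.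
Proof.
move=> /andP[_ /eqP wij] /rsetP[ab wP] /arc_downP[ai ei aj jb].
apply/val_inj/eqP; rewrite /= eqn_leq ai leqNgt; apply/negP => ai'.
have := wP j aj jb; have := @tamari_parabolic w a i ai'; have := e_ge i; lia.
Qed.

(** By [descents_generate], an element strictly below [w] misses some descent, so it lies below the
    element obtained by deleting the arcs above that descent. Conversely, anything between that
    element and [w] containing [(i, j)] contains every descent, since no other descent lies above
    [(i, j)]. *)
Lemma covered_descentP m (w : L) :
  reflect (exists i j, descent w i j /\ rset m = rset_minus w i j) (covered m
    w).
Proof.
apply: (iffP (coveredP _ _)) => [[mw mP]|[i [j [dij mE]]]].
  have [/existsP[p]|/existsPn nP] :=
    boolP [exists p : I * I, descent w p.1 p.2 && (p \notin rset m)].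
    case: p => i j /andP[/= dij nij]; exists i, j; split=> //.
    have mv : rset m \subset rset_minus w i j.
      apply/subsetP => q qm; rewrite in_rset_minus.
      have := ltW mw; rewrite tam_leE => /subsetP-> //=; apply: contra nij;
        exact/subsetP/rset_down.
    have [v vE] := closed_rset (rset_minus_closed dij).
    case: (mP v) => [||<-//|vw]; rewrite ?tam_leE ?vE //.
            by apply/subsetP => p; rewrite in_rset_minus => /andP[].
    have /rsetP[ij _] := descent_rset dij.
    move: (descent_rset dij); rewrite -{1}vw vE in_rset_minus arc_down_refl.
    by rewrite ij andbF.
  have mwE : m = w.
    apply: descents_generate; first by rewrite -tam_leE ltW.
    by move=> i j dij; have := nP (i, j); rewrite /= dij negbK.
  by rewrite mwE ltxx in mw.
have ij : e i < j by have /rsetP[] := descent_rset dij.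
split.
  rewrite tam_ltE mE; apply/properP; split.
    by apply/subsetP => p; rewrite in_rset_minus => /andP[].
  by exists (i, j); rewrite ?descent_rset // in_rset_minus arc_down_refl ij
    andbF.
move=> z; rewrite !tam_leE => mz zw.
have [ijz|nij] := boolP ((i, j) \in rset z).
  right; apply: descents_generate => // a b dab.
  have [ijab|nijab] := boolP ((i, j) \in arc_down (a, b)); last first.
    by apply: (subsetP mz); rewrite mE in_rset_minus descent_rset.
  have ai := descent_down dij (descent_rset dab) ijab.
  case/andP: dij => _ /eqP wi; case/andP: dab => _ /eqP wa.
  suff -> : b = j by rewrite ai.
  by apply: (@perm_val_inj _ w); rewrite ai in wa; lia.
left; apply: rset_inj; apply/eqP; rewrite eqEsubset mz andbT mE.
apply/subsetP => p pz; rewrite in_rset_minus (subsetP zw) //=.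
by apply: contra nij; exact/subsetP/rset_down.
Qed.

(** The intersection of the sets [rset_minus w i j] over all descents, hence of the arc sets of the
    lower covers. *)
Definition rset_core (w : 'S_n) :=
  [set p in rset w | [forall i : I, forall j : I, descent w i j ==> ((i, j)
    \notin arc_down p)]].

Lemma rset_coreP (w : 'S_n) p :
  reflect (p \in rset w /\ forall i j, descent w i j ->
    (i, j) \notin arc_down p)
          (p \in rset_core w).
Proof.
rewrite [p \in rset_core w]inE; apply: (iffP andP) => -[pw pP]; split=> //.
  by move=> i j dij; move/forallP/(_ i)/forallP/(_ j): pP; rewrite dij.
by apply/forallP => i; apply/forallP => j; apply/implyP/pP.
Qed.

Lemma rset_core_closed (w : Tm) : arc_closed (rset_core w).
Proof.
have [[R1 R2] R3] := rset_closed w; split; [split|].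
- by move=> a b /rset_coreP[/R1].
- move=> a b a' b' /rset_coreP[ab nij] aa ea ab' bb; apply/rset_coreP.
  split; first exact: (R2 a b).
  move=> i j dij; have [[_ M2] _] := rset_minus_closed dij.
  have : (a', b') \in rset_minus w i j by apply: (M2 a b);
    rewrite // in_rset_minus ab nij.
  by rewrite in_rset_minus => /andP[].
- move=> a k b /rset_coreP[ak nak] /rset_coreP[kb nkb] ek; apply/rset_coreP.
  split; first exact: (R3 a k).
  move=> i j dij; have [_ M3] := rset_minus_closed dij.
  have : (a, b) \in rset_minus w i j.
    by apply: (M3 a k); rewrite // in_rset_minus ?ak ?kb ?nak ?nkb.
  by rewrite in_rset_minus => /andP[].
Qed.

Lemma rset_nucleus (w : L) : rset (nucleus w) = rset_core w.
Proof.
have [/existsP[[i j] /= dij]|/existsPn no_d] :=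
  boolP [exists p : I * I, descent w p.1 p.2]; last first.
  (* Without descents the condition is void, in agreement with the convention for the bottom
     element. *)
  have coreE : rset_core w = rset w.
    apply/setP => p; apply/rset_coreP/idP => [[]//|pw]; split=> // i j dij.
    by have := no_d (i, j); rewrite /= dij.
  by rewrite /nucleus (bottom_of_no_descent no_d).
have [v vE] := closed_rset (rset_minus_closed dij).
have vw : covered v w by apply/covered_descentP; exists i, j.
rewrite /nucleus; case: ifP => [/forallP/(_ v)|_].
  by case/coveredP: vw => /lt_geF->.
have [c cE] := closed_rset (rset_core_closed w).
have cP : is_inf (@Order.le _ L) [set b | covered b w] c.
  apply/is_infP; split=> [u|t tP].
    rewrite inE tam_leE cE => /covered_descentP[a [b [dab ->]]].
    by apply/subsetP => p /rset_coreP[pw pP]; rewrite in_rset_minus pw pP.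
  rewrite tam_leE cE; apply/subsetP => p pt; apply/rset_coreP.
  have ptm a b : descent w a b -> p \in rset_minus w a b.
    move=> dab; have [u uE] := closed_rset (rset_minus_closed dab).
    rewrite -uE; apply: (subsetP _ _ pt); rewrite -tam_leE; apply: tP.
    by rewrite inE; apply/covered_descentP; exists a, b.
  split; first by have := ptm i j dij; rewrite in_rset_minus => /andP[].
  by move=> a b /ptm; rewrite in_rset_minus => /andP[].
case: pickP => [m /= mP|/(_ c)]; last by rewrite cP.
suff -> : m = c by [].
apply/le_anti; case/is_infP: mP => m1 m2; case/is_infP: cP => c1 c2.
by rewrite m2 // c2.
Qed.

(** * Labels of covers *)

Lemma covered_downE s t p : p \in arc_down p -> rset t = arc_down p ->
  covered s t = (rset s == arc_down p :\ p).
Proof.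
move=> pp tE; have star_max u : (u < t)%O -> rset u \subset arc_down p :\ p.
  rewrite tam_ltE tE subsetD1 => ut; rewrite proper_sub //=.
  by apply: contraL ut => /rset_down pu; rewrite properE pu andbF.
have star_lt u : rset u = arc_down p :\ p -> (u < t)%O.
  by move=> uE; rewrite tam_ltE uE tE properD1.
apply/coveredP/eqP => [[st sP]|sE].
  have [v vE] := closed_rset (arc_star_closed p).
  have [||<-//|vt] := sP v; rewrite ?tam_leE ?vE ?star_max //.
    by rewrite -vE -tam_leE ltW ?star_lt.
  by have := star_lt v vE; rewrite vt ltxx.
split=> [|z sz zt]; first exact: star_lt.
have [->|zt'] := eqVneq z t; [by right|left].
apply/le_anti; rewrite sz andbT tam_leE sE star_max // lt_neqAle zt'.
by rewrite zt.
Qed.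

Lemma rset_lower_star t p : p \in arc_down p -> rset t = arc_down p ->
  rset (lower_star t) = arc_down p :\ p.
Proof.
move=> pp tE; have [s sE] := closed_rset (arc_star_closed p).
rewrite /lower_star; case: pickP => [u|/(_ s)] /=;
  rewrite (covered_downE _ pp tE).
  by move/eqP.
by rewrite sE eqxx.
Qed.

Lemma covered_join x y z : covered x y -> (z <= y)%O -> ~~ (z <= x)%O ->
  is_join z x y.
Proof.
move=> /coveredP[xy yP] zy zx; apply/is_supP; split=> [u /set2P[]->//|t tP].
  exact: ltW.
have [v vE] := tam_meet t y.
have zt : (z <= t)%O by apply: tP; rewrite set21.
have xt : (x <= t)%O by apply: tP; rewrite set22.
have [||vx|vy] := yP v; rewrite ?tam_leE ?vE ?subsetI ?subsetIr //.
- by rewrite -!tam_leE xt ltW.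
- by case/negP: zx; rewrite tam_leE -vx vE subsetI -!tam_leE zt zy.
- by rewrite -vy vE subsetIl.
Qed.

(** Here [t] joins with [x] to [y] and meets [x] in [lower_star t], so the two covers are
    perspective and are collapsed by the same congruences. *)
Lemma cg_perspective x y t p : covered x y -> p \in rset y :\: rset x ->
  arc_down p :\ p \subset rset x -> rset t = arc_down p -> cgj t = cg x y.
Proof.
move=> xy /setDP[py px] sx tE.
have pp : p \in arc_down p by rewrite arc_down_refl;
  case: p py {px sx tE} => a b /rsetP[].
have sE := rset_lower_star pp tE; set s := lower_star t in sE *.
have ty : (t <= y)%O by rewrite tam_leE tE rset_down.
have tx : ~~ (t <= x)%O by rewrite tam_leE tE; apply: contra px => /subsetP->.
have xley : (x <= y)%O by case/coveredP: xy => /ltW.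
rewrite /cgj /cg -/s; apply: eq_bigl => th.
case thP: (lattice_congruence th) => //=; apply/idP/idP => [st|xyth].
  apply: (congruence_join thP st (congruence_refl thP x)).
    apply/is_joinP; by split=> //; rewrite sE.
  exact: covered_join.
apply: (congruence_meet thP xyth (congruence_refl thP t)); rewrite is_meetE ?sE.
  rewrite tE eqEsubset subsetI sx subD1set /=.
  by rewrite subsetD1 subsetIr inE (negPf px).
by rewrite eq_sym; apply/eqP/setIidPr; rewrite -tam_leE.
Qed.

(* Contracting the arcs outside S is a congruence as soon as S contains both
   factors of every composition (i, k), (k, l) giving an arc (i, l) of S. *)
Lemma arc_trace_congruence S :
    (forall i k l, (i, l) \in S -> e i < k -> k < l -> e k = k :> nat ->
       (i, k) \in S /\ (k, l) \in S) ->
  lattice_congruence [set xy : L * L | rset xy.1 :&: S == rset xy.2 :&: S].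
Proof.
move=> SP; apply/and5P; split.
- by apply/forallP => x; rewrite inE.
- by apply/forallP => x; apply/forallP => y; apply/implyP; rewrite !inE eq_sym.
- apply/forallP => x; apply/forallP => y; apply/forallP => z; apply/implyP.
  by rewrite !inE /= => /andP[/eqP->].
- have half x x' y y' z z' : rset x :&: S = rset x' :&: S ->
      rset y :&: S = rset y' :&: S -> is_join x y z -> is_join x' y' z' ->
      rset z :&: S \subset rset z' :&: S.
    move=> xx' yy' /is_joinP[xz yz zmin] /is_joinP[xz' yz' _].
    (* [K] collects the arcs of [z] whose down-set has its trace on [S] inside [z']. It is
       arc-closed and contains the arcs of [x] and [y], hence those of their join [z]. *)
    pose K := [set p in rset z | arc_down p :&: S \subset rset z'].
    have KE p : (p \in K) = (p \in rset z) && (arc_down p :&: S \subset rset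
      z').
      by rewrite inE.
    have KP : arc_closed K.
      have [[R1 R2] R3] := rset_closed z; split; [split|].
      + by move=> i j; rewrite KE => /andP[/R1].
      + move=> i j i' j'; rewrite !KE => /andP[ij ijS] ii' ee ij' jj'.
        rewrite (R2 i j) //=; apply: subset_trans ijS; apply: setSI.
        by apply: arc_down_trans; apply/arc_downP.
      + move=> i k l; rewrite !KE => /andP[ik ikS] /andP[kl klS] ek.
        rewrite (R3 i k) //=; apply/subsetP =>
          -[a b] /setIP[/arc_downP[ia ea ib bl] abS].
        have ik' := R1 _ _ ik.
        have [bk|kb] := leqP b k.
          by apply: (subsetP ikS); rewrite inE abS andbT; apply/arc_downP.
        have [akS kbS] : (a, k) \in S /\ (k, b) \in S by apply: SP; rewrite ?ea.
        have [_ R3'] := rset_closed z'.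
        apply: (R3' a k b) => //.
          by apply: (subsetP ikS); rewrite inE akS andbT; apply/arc_downP;
            split.
        by apply: (subsetP klS); rewrite inE kbS andbT; apply/arc_downP; split;
          rewrite ?ek.
    have sub u u' : rset u :&: S = rset u' :&: S -> rset u \subset rset z ->
        rset u' \subset rset z' -> rset u \subset K.
      move=> uu' uz uz'; apply/subsetP => p pu; rewrite KE (subsetP uz) //=.
      apply: subset_trans uz'; apply: subset_trans (subsetIl _ S); rewrite -uu'.
      exact/setSI/rset_down.
    have zK : rset z \subset K by apply: zmin => //;
      [apply: sub xz'|apply: sub yz'].
    apply/subsetP => p /setIP[pz pS]; rewrite inE pS andbT.
    have := subsetP zK p pz; rewrite KE => /andP[_ /subsetP]; apply.
    rewrite inE pS andbT arc_down_refl.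
    by case: p pz {pS} => i j /rsetP[].
  apply/forallP => x; apply/forallP => x'; apply/forallP => y;
    apply/forallP => y'.
  apply/forallP => z; apply/forallP => z'; apply/implyP; rewrite !inE /=.
  case/and4P => /eqP xx' /eqP yy' zJ zJ'; rewrite eqEsubset.
  by rewrite (half x x' y y') // (half x' x y' y).
- apply/forallP => x; apply/forallP => x'; apply/forallP => y;
  apply/forallP => y'.
  apply/forallP => z; apply/forallP => z'; apply/implyP;
    rewrite !inE /= !is_meetE.
  case/and4P => /eqP xx' /eqP yy' /eqP-> /eqP->.
  by rewrite !(setIC (rset x)) !(setIC (rset x')) -!setIA xx' !setIA !(setIC _
    S) !setIA
    -!(setIC (rset _)) yy'.
Qed.

Lemma arc_cg_inj s t p q : p \in arc_down p -> q \in arc_down q ->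
  rset s = arc_down p -> rset t = arc_down q -> cgj s = cgj t -> p = q.
Proof.
wlog le_pq : s t p q / p.2 - p.1 <= q.2 - q.1.
  move=> IH pp qq sE tE st;
    have [le_pq|/ltnW le_qp] := leqP (p.2 - p.1) (q.2 - q.1).
    exact: (IH s t).
  by apply/esym/(IH t s).
move=> pp qq sE tE st; apply/eqP/negP => /negP pq.
(* Both factors of a composition are strictly shorter than the composite, so [arc_trace_congruence]
   applies to [p] together with everything shorter. As [q] is at least as long and different, this
   congruence collapses the cover below [t] but not the one below [s]. *)
pose S := [set r : I * I | (r == p) || (r.2 - r.1 < p.2 - p.1)].
have SP : lattice_congruence [set xy :
  L * L | rset xy.1 :&: S == rset xy.2 :&: S].
  apply: arc_trace_congruence => i k l; rewrite !inE /= => ilS ik kl ek.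
  have le_il : l - i <= p.2 - p.1 by case/orP: ilS => [/eqP<-|/ltnW].
  have := e_ge i; split; apply/orP; right; lia.
have qS : q \notin S by rewrite inE eq_sym (negPf pq) -leqNgt.
have pS : p \in S by rewrite inE eqxx.
have tS : (lower_star t, t) \in [set xy :
  L * L | rset xy.1 :&: S == rset xy.2 :&: S].
  rewrite inE /= (rset_lower_star qq tE) tE; apply/eqP/setP => r;
    rewrite !inE -/S.
  by case: eqVneq => //= ->; move: qS; rewrite inE => /negPf->; rewrite andbF.
have : (lower_star s, s) \in cgj t.
  by rewrite -st; apply/bigcapP => th /andP[].
move/bigcapP/(_ _ (introT andP (conj SP tS))).
rewrite inE /= (rset_lower_star pp sE) sE => /eqP/setP/(_ p).
by rewrite !in_setI in_setD1 eqxx pp pS.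
Qed.

(** The element generated by a descent of [t] joins with the matching lower cover to [t];
    irreducibility then identifies it with [t]. *)
Lemma join_irreducibleP t :
  reflect (exists2 p, p \in arc_down p & rset t = arc_down p) (join_irreducible
    t).
Proof.
apply: (iffP andP) => [[nbot /forallP tP]|[p pp tE]]; last first.
  have nb : ~~ is_bottom t.
    apply/negP => /forallP/(_ (lower_star t)).
    rewrite tam_leE (rset_lower_star pp tE) tE subsetD1.
    by rewrite pp andbF.
  split=> //; apply/forallP => x; apply/forallP => y;
    apply/implyP => /is_joinP[xt yt tmin].
  apply: contraT => /norP[tx ty].
  have sub u : rset u \subset rset t -> t != u ->
    rset u \subset arc_down p :\ p.
    rewrite tE subsetD1 => ut; rewrite ut => /= tu; apply: contra tu => pu.
    by apply/eqP/rset_inj/eqP; rewrite tE eqEsubset ut rset_down.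
  have := tmin _ (arc_star_closed p) (sub x xt tx) (sub y yt ty).
  by rewrite tE subsetD1 pp andbF.
have [/existsP[[i j] /= dij]|/existsPn no_d] :=
  boolP [exists p : I * I, descent t p.1 p.2]; last first.
  by rewrite (bottom_of_no_descent no_d) in nbot.
have ij := descent_rset dij.
have ijd : (i, j) \in arc_down (i, j) by rewrite arc_down_refl; case/rsetP: ij.
have [m mE] := closed_rset (rset_minus_closed dij).
have [x xE] := closed_rset (arc_down_closed (i, j)).
have mt : covered m t by apply/covered_descentP; exists i, j.
have nxm : (i, j) \notin rset m by rewrite mE in_rset_minus ijd andbF.
have xJ : is_join x m t.
  apply: covered_join => //; first by rewrite tam_leE xE rset_down.
  by rewrite tam_leE xE; apply: contra nxm => /subsetP->.
have /forallP/(_ m)/implyP/(_ xJ)/orP[/eqP->|/eqP tm] := tP x.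
  by exists (i, j).
by case/coveredP: mt; rewrite tm ltxx.
Qed.

(** * Core label sets *)

(** For [w] in the lattice, these are the arcs composed of descents at ends of regions; see
    [label_arcs_comp] and [label_arcs_ind]. *)
Definition label_arcs (w : 'S_n) : {set I * I} :=
  [set p in rset w | [forall k : I, (w p.2 < w k < w p.1) ==>
     [&& p.1 < k, k < p.2 & e k == k :> nat]]].

Lemma label_arcsP (w : 'S_n) i j :
  reflect ((i, j) \in rset w /\ forall k, w j < w k -> w k < w i ->
             [/\ i < k, k < j & e k = k :> nat])
          ((i, j) \in label_arcs w).
Proof.
rewrite [_ \in label_arcs w]inE; apply: (iffP andP) => -[ijw wP]; split=> //.
  move=> k jk ki; move/forallP/(_ k): wP; rewrite jk ki /=.
  by case/and3P => ? ? /eqP.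
apply/forallP => k; apply/implyP => /andP[/= jk ki].
by have [-> -> ->] := wP k jk ki; rewrite eqxx.
Qed.

(** The chain of values from [w i] down to [w j] moves to the right: if [l] preceded [k],
    [tamari_block] would give a position in the region of [k] with value below [w l]; as it closes
    its region, it would be [k] itself. *)
Lemma label_arcs_chain (w : Tm) i j k l : (i, j) \in label_arcs w ->
  w j < w l -> w l < w k -> w k < w i -> k < l.
Proof.
case/label_arcsP => _ wP jl lk ki.
have [ik kj ek] := wP k (ltn_trans jl lk) ki.
have [il lj el] := wP l jl (ltn_trans lk ki).
rewrite ltnNge; apply/negP => le_lk.
have [||x xk /andP[jx xl]] := @tamari_block w l k j _ _ jl lk; try lia.
  by rewrite el ltn_neqAle le_lk andbT; apply/eqP => /val_inj lkE;
    rewrite lkE ltnn in lk.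
have [ix xj ex] := wP x jx ltac:(lia).
have xE : x = k by apply/val_inj => /=; lia.
by rewrite xE in xl; lia.
Qed.

(* The candidates (k, j) with k in the chain from i down to j compose with arcs
   strictly below (i, j) to (i, j), so none of them lies in x and hence none
   survives in the nucleus of w: each k is the start of a descent of w. *)
Lemma label_arcs_of_nucleus (w : L) x i j : rset_core w \subset rset x ->
  (i, j) \in rset w -> (i, j) \notin rset x ->
  arc_down (i, j) :\ (i, j) \subset rset x -> (i, j) \in label_arcs w.
Proof.
move=> cx ijw nijx sx; apply/label_arcsP; split=> //.
have /rsetP[ij wij] := ijw.
suff chain k : w j < w k -> w k < w i ->
    [/\ i < k, k < j, e k = k :> nat & forall y : I, w k < w y -> w y < w i ->
      y < k].
  by move=> k jk ki; have [] := chain k jk ki.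
have [d] := ubnP (w i - w k); elim: d k => // d IHd k le_d jk ki.
have [a wa] : exists a, w a = (w k).+1 :> nat.
  by apply: perm_preim; have := ltn_ord (w i); lia.
have aP : a = i \/ [/\ e i < a, a < j, e a = a :> nat & forall y :
  I, w a < w y -> w y < w i -> y < a].
  have [/perm_val_inj->|ne] := eqVneq (w a : nat) (w i); first by left.
  right; have [|||ia aj ea aP] := IHd a; try lia; split=> //.
  rewrite ltnNge; apply/negP => ae.
  by have := @tamari_parabolic w i a ia ae; lia.
have ajw : (a, j) \in rset w.
  case: aP => [->//|[ia aj ea aP]]; apply/rsetP; split; first by rewrite ea.
  move=> y ay yj; rewrite perm_lt_total; last by lia.
  apply/negP => way; have := aP y way (wij y _ yj); lia.
have najx : (a, j) \notin rset x.
  case: aP => [->//|[ia aj ea aP]]; apply: contra nijx => ajx.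
  have [_ R3] := rset_closed x; apply: (R3 i a) => //.
  apply: (subsetP sx); rewrite in_setD1 xpair_eqE negb_and -!val_eqE /=.
  rewrite (ltn_eqF aj) orbT; apply/arc_downP; split=> //; exact: ltnW.
have ak : [/\ e a < k & k <= j].
  have : (a, j) \notin rset_core w by apply: contra najx => /(subsetP cx).
  rewrite inE ajw /= negb_forall => /existsP[b];
    rewrite negb_forall => /existsP[c].
  rewrite negb_imply negbK => /andP[dbc bc].
  have ab := descent_down dbc ajw bc; rewrite -ab in dbc bc.
  have ck : c = k.
    case/andP: dbc => _ /eqP wac.
    by apply: (@perm_val_inj _ w); apply: succn_inj; rewrite -wa wac.
  by case/arc_downP: bc; rewrite ck.
case: ak => ak kj; have {}kj : k < j.
  by rewrite ltn_neqAle kj andbT; apply/eqP => /val_inj kj';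
    rewrite kj' ltnn in jk.
have eik : e i < k by case: aP => [<-|[ia aj ea _]]; lia.
have aboveP (y : I) : w k < w y -> w y < w i -> y < k.
  move=> ky yi; have := e_ge a.
  have [/perm_val_inj->|ne] := eqVneq (w y : nat) (w a); first by lia.
  case: aP => [aE|[_ _ _ /(_ y)]]; last by lia.
  by rewrite aE in wa ne; lia.
split=> //; first by have := e_ge i; lia.
apply/eqP; rewrite eqn_leq e_ge andbT leqNgt; apply/negP => kek.
have wkek : w k < w (e k) by apply: tamari_parabolic.
have [jek|ekj] := leqP j (e k); first by have := @tamari_parabolic w k j kj jek;
  lia.
have := aboveP (e k) wkek (wij _ _ (ltnW ekj)); lia.
Qed.

(* These are the arcs of w below the largest arc-closed set that contains all
   arcs strictly below (i, j) but not (i, j) itself. *)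
Definition rset_kappa (w : 'S_n) i j :=
  [set q in rset w | ~~ [&& j <= q.2 &
     ((q.1 <= i) && (e q.1 == e i :> nat)) || (e i < q.1) && (e q.1 < j)]].

Lemma in_rset_kappa (w : 'S_n) i j a b :
  ((a, b) \in rset_kappa w i j) = ((a, b) \in rset w) && ~~ [&& j <= b &
     ((a <= i) && (e a == e i :> nat)) || (e i < a) && (e a < j)].
Proof. by rewrite inE. Qed.

(** If a composite through [k] is excluded, its first factor is excluded when [j <= k]; otherwise
    [k] closes a region strictly between those of [i] and [j], and the second factor is excluded. *)
Lemma rset_kappa_closed (w : Tm) i j : arc_closed (rset_kappa w i j).
Proof.
have [[R1 R2] R3] := rset_closed w; split; [split|].
- by move=> a b; rewrite in_rset_kappa => /andP[/R1].
- move=> a b a' b'; rewrite !in_rset_kappa => /andP[ab nab] aa ea ab' bb.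
  rewrite (R2 a b) //=; apply: contra nab => /andP[jb aP].
  rewrite (leq_trans jb bb) -ea /=; case/orP: aP => /andP[ai ei]; apply/orP;
    [left|right].
    by rewrite (leq_trans aa ai).
  rewrite ei andbT ltnNge; apply/negP => /e_mono; rewrite e_id -ea.
  by have := e_ge a'; lia.
- move=> a k b; rewrite !in_rset_kappa => /andP[ak nak] /andP[kb nkb] ek.
  rewrite (R3 a k) //=; apply: contra nkb => /andP[jb aP].
  have ak' := R1 _ _ ak; rewrite jb /=; apply/orP; right.
  move: nak; rewrite aP andbT -ltnNge ek => ->; rewrite andbT.
  by case/orP: aP => /andP[ai ei]; have := e_ge a; lia.
Qed.

(** An excluded arc [(a, b)] of [w] has [w j < w a <= w i]. The position [k] of the next lower value
    is therefore on the chain of [(i, j)], so [(a, k)] is a descent below [(a, b)], and [(a, b)] is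
    not in the nucleus. *)
Lemma nucleus_sub_kappa (w : L) i j : (i, j) \in label_arcs w ->
  rset_core w \subset rset_kappa w i j.
Proof.
move=> ijP; have /label_arcsP[/rsetP[ij wij] chain] := ijP.
apply/subsetP => -[a b] /rset_coreP[abw aP]; rewrite in_rset_kappa abw /=.
apply/negP => /andP[jb]; have /rsetP[ab wab] := abw.
have next : e a < j -> w a <= w i -> (w a < w i -> i < a) -> False.
  move=> aj ai ai'; have waj := wab j aj jb.
  have [k wk] : exists k, w k = (w a).-1 :> nat.
    by apply: perm_preim; have := ltn_ord (w a); lia.
  have [ak kj] : a < k /\ k <= j.
    have [/perm_val_inj->|ne] := eqVneq (w k : nat) (w j).
      by have := e_ge a; lia.
    have [ik kj ek] : [/\ i < k, k < j & e k = k :> nat] by apply: chain; lia.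
    split; last exact: ltnW.
    move: ai; rewrite leq_eqVlt => /orP[/eqP/perm_val_inj->//|ai].
    by apply: (label_arcs_chain ijP) => //; lia.
  have dak : descent w a k by rewrite /descent ak; lia.
  case/negP: (aP _ _ dak); apply/arc_downP; split=> //;
    last exact: leq_trans jb.
  by have /descent_rset/rsetP[] := dak.
case/orP => /andP[ai ei].
  have eai : e a = e i :> nat by apply/eqP.
  apply: next; first by lia.
    move: ai; rewrite leq_eqVlt => /orP[/eqP/val_inj->//|ai].
    by apply/ltnW/tamari_parabolic => //; have := e_ge i; lia.
  by move=> wai; have [] := chain a (wab j ltac:(lia) jb) wai.
apply: next => //; last by move=> _; have := e_ge i; lia.
by apply/ltnW/wij => //; have := e_ge a; lia.
Qed.

Lemma arc_down_length p q : p \in arc_down q -> q \in arc_down q -> p != q ->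
  p.2 - p.1 < q.2 - q.1.
Proof.
case: p => c d; case: q => a b /arc_downP[ac ec ad db] /arc_downP[_ _ ab _].
rewrite xpair_eqE -!val_eqE /=; have := e_ge a; have := e_ge c.
by clear -ac ec ad db ab; lia.
Qed.

Lemma core_label_setP (w t : L) :
  reflect (exists2 p, p \in label_arcs w & rset t = arc_down p) (t \in
    core_label_set w).
Proof.
rewrite inE; apply: (iffP existsP) => [[x /existsP[y]]|[[i j] ijP tE]].
  case/and4P; rewrite !tam_leE rset_nucleus =>
    wx xy yw /andP[/join_irreducibleP[q qq tE] /eqP tcg].
  have /coveredP[] := xy; rewrite tam_ltE => /properP[xsuby [p0 p0y p0x]] _.
  have p0P : p0 \in rset y :\: rset x by rewrite inE p0x.
  case: (@arg_minnP _ p0 (mem (rset y :\: rset x)) (fun r : I * I => r.2 - r.1)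
    (* A shortest new arc is minimal among the new ones, since arcs strictly below another are
       strictly shorter. *)
    p0P) => p pP pmin.
  have /setDP[py px] := pP.
  have pp : p \in arc_down p by rewrite arc_down_refl;
    case: p py {px pmin pP} => a b /rsetP[].
  have sx : arc_down p :\ p \subset rset x.
    apply/subsetP => r /setD1P[rp rd]; apply/negPn/negP => rx.
    have ry := subsetP (rset_down py) r rd.
    have rP : r \in rset y :\: rset x by rewrite in_setD rx.
    have := pmin r rP.
    by rewrite leqNgt (arc_down_length rd pp rp).
  have [s sE] := closed_rset (arc_down_closed p).
  have scg := cg_perspective xy pP sx sE.
  have pq : p = q by apply: (arc_cg_inj pp qq sE tE); rewrite scg tcg.
  exists p; last by rewrite pq.
  case: p sx px py {pmin pP pp sE scg pq} => i j sx px py.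
  by apply: label_arcs_of_nucleus px sx => //; apply: subsetP py.
have /label_arcsP[ijw _] := ijP; set p := (i, j) in ijw tE.
(* [b0] lies above the nucleus and contains everything strictly below [p] but not [p]. A minimal [y]
   above it with [p], then a maximal [x] below [y] without [p], form a cover labelled by [p]. *)
have [b0 b0E] := closed_rset (rset_kappa_closed w i j).
have b0w : rset b0 \subset rset w by rewrite b0E; apply/subsetP => q;
  rewrite inE => /andP[].
have pb0 : p \notin rset b0 by rewrite b0E in_rset_kappa ijw !leqnn eqxx.
have sb0 : arc_down p :\ p \subset rset b0.
  rewrite b0E; apply/subsetP => -[a b] /setD1P[ne abd].
  rewrite in_rset_kappa (subsetP (rset_down ijw)) //=; apply: contra ne.
  case/arc_downP: abd => ia ea ib bj /andP[jb].
  by rewrite xpair_eqE -!val_eqE /=; have := e_ge a; lia.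
pose Py := [pred y :
  L | [&& rset b0 \subset rset y, rset y \subset rset w & p \in rset y]].
have Pw : Py w by rewrite /= b0w subxx.
case: (@arg_minnP _ w Py (fun y => #|rset y|) Pw) => y /and3P[b0y yw py] ymin.
pose Px := [pred x :
  L | [&& rset b0 \subset rset x, rset x \subset rset y & p \notin rset x]].
have Pb0 : Px b0 by rewrite /= subxx b0y.
case: (@arg_maxnP _ b0 Px (fun x => #|rset x|) Pb0) => x /and3P[b0x xy px] xmax.
have cxy : covered x y.
  apply/coveredP; rewrite tam_ltE; split; first by apply/properP; split=> //;
    exists p.
  move=> z; rewrite !tam_leE => xz zy; have [pz|pz] := boolP (p \in rset z).
    right; apply/rset_inj/eqP; rewrite eqEcard zy ymin //=.
    by rewrite (subset_trans b0x xz) (subset_trans zy yw).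
  left; apply/rset_inj/esym/eqP; rewrite eqEcard xz; apply: xmax.
  by rewrite /= (subset_trans b0x xz) zy.
have sx := subset_trans sb0 b0x.
exists x; apply/existsP; exists y; rewrite !tam_leE rset_nucleus cxy yw.
rewrite (subset_trans _ b0x) /=; last by rewrite b0E nucleus_sub_kappa.
apply/andP; split.
  by apply/join_irreducibleP; exists p => //; rewrite arc_down_refl;
    case/rsetP: ijw.
by apply/eqP/(cg_perspective cxy _ sx tE); rewrite inE px.
Qed.

Lemma arc_down_inj p q : p \in arc_down p -> q \in arc_down q ->
  arc_down p = arc_down q -> p = q.
Proof.
case: p => a b; case: q => c d pp qq pq.
have /arc_downP[ac _ _ db] : (c, d) \in arc_down (a, b) by rewrite pq.
have /arc_downP[ca _ _ bd] : (a, b) \in arc_down (c, d) by rewrite -pq.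
by congr pair; apply/val_inj => /=; lia.
Qed.

Lemma label_arcs_arc (w : 'S_n) p : p \in label_arcs w -> p \in arc_down p.
Proof. by case: p => i j /label_arcsP[/rsetP[ij _] _];
  rewrite arc_down_refl. Qed.

Lemma CLO_E u v : CLO (u : L) (v : L) = (label_arcs u \subset label_arcs v).
Proof.
apply/idP/idP => /subsetP uv; apply/subsetP; last first.
  move=> t /core_label_setP[p /uv pv tE].
  by apply/core_label_setP; exists p.
move=> p pu.
have [t tE] := closed_rset (arc_down_closed p).
have /uv/core_label_setP[q qv] : t \in core_label_set (u : L).
  by apply/core_label_setP; exists p.
rewrite tE => pq; rewrite (arc_down_inj _ _ pq) //.
  exact: label_arcs_arc pu.
exact: label_arcs_arc qv.
Qed.

(** * The core label order *)

Lemma descent_label (w : Tm) i j : descent w i j -> (i, j) \in label_arcs w.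
Proof.
move=> dij; apply/label_arcsP; split; first exact: descent_rset.
by case/andP: dij => _ wij k; lia.
Qed.

Lemma label_arcs_split (w : Tm) i j k : (i, j) \in label_arcs w ->
  w j < w k -> w k < w i ->
  (i, k) \in label_arcs w /\ (k, j) \in label_arcs w.
Proof.
move=> ijP jk ki; have /label_arcsP[/rsetP[ij wij] chain] := ijP.
have [ik kj ek] := chain k jk ki.
have ik' := inversion_far ik ki.
split; apply/label_arcsP; split.
- by apply/rsetP; split=> // l il lk; apply: wij => //; lia.
- move=> l kl li; have [il lj el] := chain l (ltn_trans jk kl) li; split=> //.
  exact: label_arcs_chain ijP jk kl li.
- apply/rsetP; split; first by rewrite ek.
  move=> l kl lj; rewrite perm_lt_total; last by lia.
  apply/negP => wkl; have li : w l < w i by apply: wij => //; lia.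
  by have := label_arcs_chain ijP jk wkl li; lia.
- move=> l jl lk; have [il lj el] := chain l jl (ltn_trans lk ki); split=> //.
  exact: label_arcs_chain ijP jl lk ki.
Qed.

Lemma label_arcs_diff (w : Tm) i j k : (i, j) \in label_arcs w ->
  (i, k) \in label_arcs w -> j < k -> (j, k) \in label_arcs w.
Proof.
move=> /label_arcsP[ijw ijP] ikP jk; have /label_arcsP[ikw _] := ikP.
have ji := rset_lt ijw; have ki := rset_lt ikw.
have kj : w k < w j.
  rewrite perm_lt_total; last by lia.
  by apply/negP => wjk; have [] := ijP k wjk ki; lia.
by case: (label_arcs_split ikP kj ji).
Qed.

Lemma label_arcs_comp (w : Tm) i j k : (i, k) \in label_arcs w ->
  (k, j) \in label_arcs w -> e k = k :> nat -> (i, j) \in label_arcs w.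
Proof.
move=> /label_arcsP[ikw ikP] /label_arcsP[kjw kjP] ek.
have [[R1 _] R3] := rset_closed w.
have ik := R1 _ _ ikw; have kj := R1 _ _ kjw.
apply/label_arcsP; split; first exact: (R3 i k).
move=> l jl li; have := e_ge i; have := e_ge k.
have [/perm_val_inj->|ne] := eqVneq (w l : nat) (w k); first by split=> //; lia.
have [kl|lk] := ltnP (w k) (w l).
  by have [] := ikP l kl li; split=> //; lia.
by have [] := kjP l jl ltac:(lia); split=> //; lia.
Qed.

(** A noncrossing property: if [d <= b], then [w d < w a < w c], and as an intermediate value of
    [(c, d)] the position [a] would lie to the right of [c]. *)
Lemma label_arcs_nest (w : Tm) a b c d : (a, b) \in label_arcs w ->
  (c, d) \in label_arcs w -> e a = e c :> nat -> a < c -> b < d.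
Proof.
move=> /label_arcsP[/rsetP[ab wab] _] /label_arcsP[/rsetP[cd _] cdP] eac ac.
rewrite ltnNge; apply/negP => db.
have wda : w d < w a by apply: wab; rewrite // eac.
have wac : w a < w c by apply: tamari_parabolic => //; have := e_ge c; lia.
by have [] := cdP a wda wac; lia.
Qed.

(** The value just below [w i] splits a label arc into a descent and a label arc with a smaller gap
    in value. *)
Lemma label_arcs_ind (w : Tm) (A : {set I * I}) :
    (forall i j, descent w i j -> (i, j) \in A) ->
    (forall i k j, (i, k) \in A -> (k, j) \in A -> e k = k :> nat ->
      (i, j) \in A) ->
  label_arcs w \subset A.
Proof.
move=> dA A3; apply/subsetP => -[i j]; have [d] := ubnP (w i - w j).
elim: d i => // d IHd i le_d ijP; have /label_arcsP[ijw chain] := ijP.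
have ji := rset_lt ijw.
have [wij|ne] := eqVneq (w i : nat) (w j).+1.
  by apply: dA; rewrite /descent wij eqxx andbT; case/rsetP: ijw;
    have := e_ge i; lia.
have [k wk] : exists k, w k = (w i).-1 :> nat.
  by apply: perm_preim; have := ltn_ord (w i); lia.
have [||ik kj ek] := chain k; try lia.
apply: (A3 i k) => //; first by apply: dA; rewrite /descent ik; lia.
apply: IHd; first by lia.
by have [] : (i, k) \in label_arcs w /\ (k, j) \in label_arcs w by apply:
  label_arcs_split ijP _ _; lia.
Qed.

Lemma label_arcs_inj u v : label_arcs u = label_arcs v -> u = v.
Proof.
have half x y : label_arcs x = label_arcs y -> rset x \subset rset y.
  move=> xy; have [z zE] := tam_meet x y.
  have <- : z = x.
    apply: descents_generate; first by rewrite zE subsetIl.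
    move=> i j dij; rewrite zE inE descent_rset //=.
    by have := descent_label dij; rewrite xy => /label_arcsP[].
  by rewrite zE subsetIr.
by move=> uv; apply/rset_inj/eqP; rewrite eqEsubset !half.
Qed.

(** [R] is the down-closure of [A], and the inversions of [w] are the pairs connected along [R].
    Connected pairs are inverted in both [u] and [v], which carries intermediate values back to
    these two. *)
Lemma label_arcsI u v : exists w, label_arcs w = label_arcs u :&: label_arcs v.
Proof.
set A := _ :&: _.
pose R : {set I * I} := \bigcup_(p in A) arc_down p.
have RI q p : p \in A -> q \in arc_down p -> q \in R by move=> pA qp;
  apply/bigcupP; exists p.
have RP : down_closed R.
  split=> [i j /bigcupP[p _]|i j i' j' /bigcupP[p pA ijp] *].
    by case: (arc_down_closed p) => -[+ _] _; apply.
  by apply: (RI _ p pA); case: (arc_down_closed p) => -[_ +] _; apply; eauto.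
have [w wP] := tamari_of_arcs RP.
pose conn := connect (fun i j => (i, j) \in R).
have R_conn i j : (i, j) \in R -> conn i j by move=> ?; apply: connect1.
have Au p : p \in A -> p \in label_arcs u by case/setIP.
have Av p : p \in A -> p \in label_arcs v by case/setIP.
have lab_r (x : Tm) p : p \in label_arcs x -> p \in rset x.
  by case: p => i j /label_arcsP[].
have conn_lt (x : Tm) i j : (forall p, p \in A -> p \in label_arcs x) ->
    conn i j -> i != j -> x j < x i.
  move=> Ax /connectP[s]; elim: s i => [i _ ->|k s IHs i] /=;
    first by rewrite eqxx.
  case/andP=> /bigcupP[p /Ax/lab_r/rset_down/subsetP px /px/rset_lt ki] ks jE _.
  have [->//|kj] := eqVneq j k; apply: ltn_trans ki; apply: IHs => //.
  by rewrite eq_sym.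
have conn_le i j : conn i j -> i <= j by apply: arc_connect_le.
have Aw : A \subset rset w.
  apply/subsetP => -[i j] ijA; have /rsetP[ij _] := lab_r _ _ (Au _ ijA).
  apply/rsetP; split=> // k ik kj; rewrite wP; last by have := e_ge i; lia.
  by apply/R_conn/(RI _ (i, j)) => //; apply/arc_downP.
(* [(j, l)] lies below the difference [(j, b)]. If [l] shared the region of [j], its value in [u]
   would be intermediate for [(a, j)], forcing [l < j]. *)
have extend a j b l : (a, j) \in A -> (a, b) \in A -> j < l -> l <= b ->
  (j, l) \in R.
  move=> ajA abA jl lb; have jb : j < b := leq_trans jl lb.
  have jbA : (j, b) \in A.
    by rewrite inE (label_arcs_diff (Au _ ajA)) ?(label_arcs_diff (Av _ ajA))
      ?Au ?Av.
  apply: (RI _ _ jbA); apply/arc_downP; split=> //; rewrite ltnNge;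
    apply/negP => le_l.
  have /label_arcsP[/rsetP[aj _] chain] := Au _ ajA.
  have /label_arcsP[/rsetP[_ uab] _] := Au _ abA.
  have ujl : u j < u l by apply: tamari_parabolic.
  by have [] := chain l ujl (uab l ltac:(lia) lb); lia.
have A_label i j : (i, j) \in A -> (i, j) \in label_arcs w.
  move=> ijA; apply/label_arcsP; split; first exact: (subsetP Aw).
  have /label_arcsP[/rsetP[ij _] chain] := Au _ ijA.
  have ij' : i < j by have := e_ge i; lia.
  move=> k jk ki.
  have ik : i < k.
    rewrite ltnNge; apply/negP => le_ki.
    have {le_ki}ltki : k < i.
      by rewrite ltn_neqAle le_ki andbT; apply/eqP => /val_inj kE;
        rewrite kE ltnn in ki.
    have nconn : ~~ conn k i by rewrite -[conn k i]wP // -leqNgt ltnW.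
    have kj : conn k j by rewrite -[conn k j]wP // (ltn_trans ltki).
    (* The path jumps over [i]. From an earlier region, the jump would connect [k] to [i]. From the
       region of [i], it comes from an arc [(a, b)] of [A] with [a < i], and noncrossing makes the
       value of [a] in [u] intermediate for [(i, j)], a contradiction. *)
    have [p [q [kp pq qj le_p iq]]] := arc_connect_jump kj (ltnW ltki) ij'.
    have /bigcupP[[a b] abA /arc_downP[ap ep aq qb]] := pq.
    have [ip|lt_p] := leqP i (e p); last first.
      case/negP: nconn; apply: connect_trans kp _; apply/R_conn/(RI _ _ abA).
      by apply/arc_downP; split; rewrite -?ep // (leq_trans (ltnW iq)).
    have ei : e i = e p :> nat by apply: e_eq.
    have ltpi : p < i.
      rewrite ltn_neqAle le_p andbT; apply/eqP => /val_inj pE.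
      by case/negP: nconn; rewrite -pE.
    have ai : a < i := leq_ltn_trans ap ltpi.
    have bj : b < j by apply: (label_arcs_nest (Au _ abA) (Au _ ijA));
      rewrite // ei ep.
    have ujq : u j < u q.
      by apply: (conn_lt u) => //; apply: contraTneq bj => <-; rewrite -leqNgt.
    have uqa : u q < u a.
      by have /lab_r/rsetP[_] := Au _ abA; apply.
    have uai : u a < u i by apply: tamari_parabolic; rewrite // -ep.
    by have [ia _ _] := chain a (ltn_trans ujq uqa) uai;
      rewrite ltnNge (ltnW ai) in ia.
  have kj : k < j.
    rewrite ltnNge; apply/negP => le_jk.
    have {le_jk}jk' : j < k.
      by rewrite ltn_neqAle le_jk andbT; apply/eqP => /val_inj kE;
        rewrite kE ltnn in jk.
    have nconn : ~~ conn j k by rewrite -[conn j k]wP // -leqNgt ltnW.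
    have ikc : conn i k by rewrite -[conn i k]wP.
    (* The path jumps over [j]; the aim is to replace the jump by an arc [(j, q)], which connects
       [j] to [k] against the order of their values. *)
    have [p [q [ip pq qk pj jq]]] := arc_connect_jump ikc (ltnW ij') jk'.
    have /bigcupP[[a b] abA /arc_downP[ap ep aq qb]] := pq.
    case/negP: nconn; apply: connect_trans qk; apply/R_conn.
    have [jp|lt_p] := leqP j (e p).
      apply: (RI _ _ abA); have ej := e_eq pj jp.
      by apply/arc_downP; split; rewrite ?ej // (leq_trans ap).
    have pjA : (p, j) \in A.
      have [<-//|ne] := eqVneq i p.
      have pjR : (p, j) \in R.
        apply: (RI _ _ abA); apply/arc_downP; split; rewrite -?ep //.
        exact: leq_trans (ltnW jq) qb.
      have pj' : p != j by apply: contraTneq lt_p => ->; rewrite -leqNgt e_ge.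
      have between x : (forall p, p \in A -> p \in label_arcs x) ->
        (p, j) \in label_arcs x.
        move=> Ax; have pi := conn_lt x i p Ax ip ne.
        have jp := conn_lt x p j Ax (R_conn _ _ pjR) pj'.
        by case: (label_arcs_split (Ax _ ijA) jp pi).
      by rewrite inE !between.
    have ap' : a = p.
      apply/val_inj/eqP; rewrite /= eqn_leq ap leqNgt; apply/negP => ltap.
      have := label_arcs_nest (Au _ abA) (Au _ pjA) (esym ep) ltap.
      by rewrite ltnNge (leq_trans (ltnW jq)).
    by rewrite ap' in abA; apply: (extend p j b).
  have ek : e k = k :> nat.
    have ikc : conn i k by rewrite -[conn i k]wP.
    have kjc : conn k j by rewrite -[conn k j]wP.
    have uki : u k < u i by apply: conn_lt ikc _ => //;
      rewrite -val_eqE /= ltn_eqF.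
    have ujk : u j < u k by apply: conn_lt kjc _ => //;
      rewrite -val_eqE /= ltn_eqF.
    by have [] := chain k ujk uki.
  by split.
exists w; apply/eqP; rewrite eqEsubset; apply/andP; split; last first.
  by apply/subsetP => -[i j]; apply: A_label.
(* Since [A] is closed under composition, descents suffice. A descent is a single arc of [R], so it
   lies below some [(i, b)] in [A]; if [b] is not [j], then [j] is intermediate for [(i, b)] in both
   [u] and [v], and splitting there gives [(i, j)]. *)
apply: label_arcs_ind => [i j dij|i k j /setIP[iku ikv] /setIP[kju kjv] ek];
  last first.
  by rewrite inE (label_arcs_comp iku) // (label_arcs_comp ikv).
have [ij wij] : i < j /\ w i = (w j).+1 :> nat by case/andP: dij => ? /eqP.
have ijc : conn i j by rewrite -[conn i j]wP // wij.
have ne : i != j by rewrite -val_eqE /=; lia.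
have [x ix xj] := arc_connect_step ijc ne.
have ix' : i < x by have := RP.1 _ _ ix; have := e_ge i; lia.
have xE : x = j.
  apply/eqP/negPn/negP => nexj.
  have xj' : x < j by rewrite ltn_neqAle conn_le // andbT.
  have wjx : w j < w x by rewrite wP.
  have : w x < w i by rewrite wP // -/(conn i x) R_conn.
  by rewrite wij ltnS leqNgt wjx.
rewrite {}xE in ix xj ix'.
have /bigcupP[[a b] abA abd] := ix.
have aE := descent_down dij (subsetP Aw _ abA) abd.
rewrite {}aE in abA abd; have /arc_downP[_ _ eij jb] := abd.
have [<-//|nejb] := eqVneq b j.
have jb' : j < b by rewrite ltn_neqAle jb andbT eq_sym.
have wbi : w b < w i by apply/rset_lt/(subsetP Aw).
have wbj : w b < w j.
  have nwb : w b != w j :> nat by apply/eqP => /perm_val_inj bj;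
    rewrite bj eqxx in nejb.
  by move: wbi; rewrite wij ltnS leq_eqVlt (negPf nwb).
have jbc : conn j b by rewrite -[conn j b]wP.
have between z : (forall p, p \in A -> p \in label_arcs z) ->
  (i, j) \in label_arcs z.
  move=> Az; have ji := conn_lt z i j Az ijc ne.
  have bj : z b < z j by apply: conn_lt jbc _ => //; rewrite eq_sym.
  by case: (label_arcs_split (Az _ abA) bj ji).
by rewrite inE !between.
Qed.

Lemma CLO_partial_order : partial_order (@CLO _ L).
Proof.
split=> [u|u v|v u w]; rewrite !CLO_E //; last exact: subset_trans.
by rewrite -eqEsubset => /eqP/label_arcs_inj.
Qed.

Lemma CLO_meet_semilattice : meet_semilattice (@CLO _ L).
Proof.
split=> [|u v]; first exact: CLO_partial_order.
have [w wE] := label_arcsI u v; exists w; apply/is_infP; split=> [x|t tP].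
  by rewrite CLO_E wE => /set2P[]->; rewrite ?subsetIl ?subsetIr.
by rewrite CLO_E wE subsetI -!CLO_E !tP ?set21 ?set22.
Qed.

(** * The maximum of the core label order *)

Lemma label_arcs_principal p : p \in arc_down p -> exists w, p \in label_arcs w.
Proof.
move=> pp; have [w wE] := closed_rset (arc_down_closed p).
have [m mE] := closed_rset (arc_star_closed p).
(* Some descent of [w] must lie outside its lower cover, and [p] is the only arc there. *)
exists w; have [/existsP[[i j] /andP[/= dij nij]]|/existsPn nP] :=
  boolP [exists q : I * I, descent w q.1 q.2 && (q \notin rset m)].
  suff -> : p = (i, j) by apply: descent_label.
  move: nij (descent_rset dij); rewrite mE wE in_setD1 negb_and negbK.
  by case/orP => [/eqP//|/negP].
have mw : m = w.
  apply: descents_generate; first by rewrite mE wE subD1set.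
  by move=> i j dij; have := nP (i, j); rewrite /= dij negbK.
by move: pp; rewrite -wE -mw mE setD11.
Qed.

Lemma CLO_topP : 
  (exists t : L, forall u : L, CLO u t) <->
  exists w, forall i j, e i < j -> (i, j) \in label_arcs w.
Proof.
split=> -[w wP]; exists w.
  move=> i j ij.
  have [|u iju] := @label_arcs_principal (i, j); first by rewrite arc_down_refl.
  by apply: subsetP iju; rewrite -CLO_E.
move=> u; rewrite CLO_E; apply/subsetP => -[i j] /label_arcs_arc.
by rewrite arc_down_refl; apply: wP.
Qed.

(** Take [i < j] in one region and [k] in another. If [k] is on the right, [(i, k)] and [(j, k)]
    violate noncrossing; if it is on the left, [j] is intermediate in value for [(k, i)] but lies to
    the right of [i]. *)
Lemma composition_of_top w : (forall i j, e i < j -> (i, j) \in label_arcs w) ->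
  alpha = [:: n] \/ alpha = nseq n 1.
Proof.
move=> wP; have /andP[alpha_gt0 /eqP alpha_sum] := alphaP.
have [/all_pred1P alphaE|/allPn[a a_in ne_a]] := boolP (all (pred1 1) alpha).
  by right; rewrite {1}alphaE -alpha_sum alphaE sumn_nseq mul1n size_nseq.
have a_gt1 : 1 < a by have /allP/(_ a a_in) := alpha_gt0; move: ne_a => /=; lia.
set m := index a alpha; have lt_m : m < size alpha by rewrite index_mem.
have psumSm : psum alpha m.+1 = psum alpha m + a by rewrite psumS nth_index.
have [le_size|lt_size] := leqP (size alpha) 1.
  left; move: alpha_sum le_size a_in {m lt_m psumSm ne_a a_gt1}.
  by case: (alpha) => [|b [|]] //=; rewrite addn0 => ->.
have psumn := psum_size alphaP.
have psumS_gt (m' : nat) : m' < size alpha -> psum alpha m' < psum alpha m'.+1.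
  move=> lt_m'; rewrite psumS -[X in X < _]addn0 ltn_add2l.
  by have /allP := alpha_gt0; apply; rewrite mem_nth.
have psum_lt (m' : nat) : m' < size alpha -> psum alpha m' < n.
  by move=> lt_m'; have := psumS_gt m' lt_m'; have := leq_psum alpha lt_m'; lia.
have lt_i := psum_lt m lt_m.
have lt_j : (psum alpha m).+1 < n.
  by have := leq_psum alpha lt_m; rewrite psumSm; lia.
pose i := Ordinal lt_i; pose j := Ordinal lt_j.
have mi : psum alpha m <= i < psum alpha m.+1 by rewrite psumSm /=; lia.
have ji : j <= e i.
  by rewrite -region_endP //= (same_regionP alphaP _ mi) psumSm /=; lia.
have ij : i < j by [].
have eij := e_eq (ltnW ij) ji.
have ei := region_end_same alphaP i; rewrite (same_regionP alphaP _ mi) in ei.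
pose m' := if m == 0 then 1 else 0.
have lt_m' : m' < size alpha by rewrite /m'; case: ifP => // _; exact: ltnW.
have lt_k := psum_lt m' lt_m'; pose k := Ordinal lt_k.
have mk : psum alpha m' <= k < psum alpha m'.+1 by rewrite leqnn psumS_gt.
have ek := region_end_same alphaP k; rewrite (same_regionP alphaP _ mk) in ek.
have [mm'|mm'] : m < m' \/ m' < m by rewrite /m'; case: posnP => [->|];
  [left|right].
  have eik : e i < k by have := leq_psum alpha mm'; move=> /=; lia.
  have ik := wP _ _ eik; have jk : (j, k) \in label_arcs w by apply: wP;
    rewrite eij.
  by have := label_arcs_nest ik jk (esym eij) ij; rewrite ltnn.
have eki : e k < i by have := leq_psum alpha mm'; move=> /=; lia.
have /label_arcsP[_ chain] := wP _ _ eki.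
have /label_arcsP[kj _] := wP k j (ltn_trans eki ij).
have [_ ]: [/\ k < j, j < i & e j = j :> nat].
  by apply: chain; [apply: tamari_parabolic|apply: rset_lt].
by rewrite ltnNge ltnW.
Qed.

(** A single region has no arcs. For singleton regions, the element with all arcs reverses the
    order, so intermediate values sit at intermediate positions. *)
Lemma top_of_composition : alpha = [:: n] \/ alpha = nseq n 1 ->
  exists w, forall i j, e i < j -> (i, j) \in label_arcs w.
Proof.
move=> alphaE; pose R := [set p : I * I | e p.1 < p.2].
have RP : arc_closed R.
  split; [split|] => [i j|i j i' j'|i k l]; rewrite !inE //=.
    by move=> _ _ ->.
  by have := e_ge k; lia.
have [w wE] := closed_rset RP; exists w => i j ij.
have ijw : (i, j) \in rset w by rewrite wE inE.
apply/label_arcsP; split=> // k jk ki; case: alphaE => alphaE.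
  have region0 (l : I) : psum alpha 0 <= l < psum alpha 1.
    by rewrite alphaE /psum /= addn0 ltn_ord.
  have := region_end_max alphaP (i := i) (j := j).
  by rewrite (same_regionP alphaP _ (region0 i)) region0 leqNgt ij => /(_ isT).
have eE (l : I) : e l = l :> nat.
  have psumE (m : nat) : m <= n -> psum alpha m = m.
    by move=> le_m; rewrite /psum alphaE take_nseq // sumn_nseq mul1n.
  have ml : psum alpha l <= l < psum alpha l.+1.
    by rewrite !psumE //; [lia|exact: ltnW].
  have := region_end_same alphaP l;
    rewrite (same_regionP alphaP _ ml) !psumE //; first by lia.
  exact: ltnW.
have w_anti a b : a < b -> w b < w a.
  by move=> ab; apply: rset_lt; rewrite wE inE /= eE.
have w_anti' a b : w b < w a -> a < b.
  move=> wba; rewrite ltnNge leq_eqVlt;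
    apply/negP => /orP[/eqP/val_inj abE|/w_anti]; last by lia.
  by rewrite abE ltnn in wba.
by split; [exact: w_anti'|exact: w_anti'|].
Qed.

End Tamari.

Theorem theorem1p2 (n : nat) (alpha : seq nat)
    (n_gt0 : 0 < n) (alpha_comp : is_composition n alpha) :
  meet_semilattice (@CLO _ (Tam n alpha)) /\
  (lattice (@CLO _ (Tam n alpha)) <->
     alpha = [:: n] \/ alpha = nseq n 1).
Proof.
have meetP := CLO_meet_semilattice alpha_comp; split; first exact: meetP.
(* The empty arc set provides the element [x0] required by [lattice_topP]. *)
have closed0 : @arc_closed n alpha (set0 : {set 'I_n * 'I_n}).
  by split; [split|] => [i j|i j i' j'|i k l]; rewrite inE.
have [x0 _] := closed_rset alpha_comp closed0.
rewrite (lattice_topP x0 meetP) (CLO_topP alpha_comp).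
split=> [[w]|]; first exact: composition_of_top.
exact: top_of_composition.
Qed.
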